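(* For $|q|<1$, with sums over $i,j,k\in\mathbb{Z}_{\ge0}$, \begin{align*} \sum \frac{q^{2i^2+j^2+\frac{1}{2}k^2+2ij+ik-i-j+\frac{1}{2}k}}{(q;q)_i(q;q)_j(q;q)_k}&=2\frac{(q^2;q^2)_\infty^2}{(q;q)_\infty^2}, \\ \sum\frac{q^{2i^2+j^2+\frac{1}{2}k^2+2ij+ik-\frac{1}{2}j+\frac{1}{2}k}}{(q;q)_i(q;q)_j(q;q)_k}&=\frac{1}{(q^{\frac{1}{2}};q)_\infty}, \\ \sum \frac{q^{2i^2+j^2+\frac{1}{2}k^2+2ij+ik+i+\frac{1}{2}k}}{(q;q)_i(q;q)_j(q;q)_k} &=\frac{(q^2;q^2)_\infty^2}{(q;q)_\infty^2}, \\ \sum\frac{q^{2i^2+j^2+\frac{1}{2}k^2+2ij+ik+\frac{1}{2}k}}{(q;q)_i(q;q)_j(q;q)_k}&=\frac{(q^2;q^2)_\infty (q^3;q^3)_\infty^2}{(q;q)_\infty^2 (q^6;q^6)_\infty}, \\ \sum\frac{q^{2i^2+j^2+\frac{1}{2}k^2+2ij+ik+2i+j+\frac{1}{2}k}}{(q;q)_i(q;q)_j(q;q)_k}&=\frac{(q^6;q^6)_\infty^2}{(q;q)_\infty (q^3;q^3)_\infty}, \\ \sum\frac{q^{4i^2+2j^2+k^2+4ij+2ik}}{(q^2;q^2)_i(q^2;q^2)_j(q^2;q^2)_k}&=\frac{1}{(q,q^3,q^4,q^8,q^9,q^{11};q^{12})_\infty},\\ \sum\frac{q^{4i^2+2j^2+k^2+4ij+2ik+4i+2j+2k}}{(q^2;q^2)_i(q^2;q^2)_j(q^2;q^2)_k}&=\frac{1}{(q^3,q^4,q^5,q^7,q^8,q^9;q^{12})_\infty}.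 \end{align*}
   Context: For $|q|<1$: $(a;q)_n=\prod_{k=0}^{n-1}(1-aq^k)$ ($(a;q)_0=1$), $(a;q)_\infty=\prod_{k\ge0}(1-aq^k)$, $(a_1,\dots,a_m;q)_\infty=\prod_\ell(a_\ell;q)_\infty$. Half-integer powers of $q$ use a fixed choice of $q^{1/2}$ (e.g. $0<q<1$). *)

(* Defs.v *)
From Stdlib Require Import Reals.
From Coquelicot Require Import Coquelicot.
Open Scope C_scope.

Fixpoint qpoch (a q : C) (n : nat) : C :=
  match n with
  | O => 1
  | S m => qpoch a q m * (1 - a * q ^ m)
  end.

Definition qpoch_inf (a q : C) : C :=
  (real (Lim_seq (fun n => Re (qpoch a q n))),
   real (Lim_seq (fun n => Im (qpoch a q n)))).

Fixpoint csum (N : nat) (f : nat -> C) : C :=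
  match N with
  | O => f O
  | S M => csum M f + f (S M)
  end.

Fixpoint rsum (N : nat) (f : nat -> R) : R :=
  match N with
  | O => f O
  | S M => (rsum M f + f (S M))%R
  end.

Definition box3 (a : nat -> nat -> nat -> C) (N : nat) : C :=
  csum N (fun i => csum N (fun j => csum N (fun k => a i j k))).

Definition box3_abs (a : nat -> nat -> nat -> C) (N : nat) : R :=
  rsum N (fun i => rsum N (fun j => rsum N (fun k => Cmod (a i j k)))).

Definition triple_sum (a : nat -> nat -> nat -> C) (l : C) : Prop :=
  (exists M : R, forall N, (box3_abs a N <= M)%R) /\
  filterlim (box3 a) eventually (locally l).

(* Main.v *)
(* The sum over k is Euler's (-t q^i; q)_oo = (-t; q)_oo / (-t; q)_i, which leaves a double sum over i, j.
   In the first three identities one sums over the value m = 2i + j, because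
   sum_{2i+j=m} q^(j(j-1)/2) / ((q^2;q^2)_i (q;q)_j) = 1 / (q;q)_m, and Euler's sum applies again.
   In the last four, with n = i + j, the sum is two applications of the limiting Bailey lemma to a pair
   with beta_i = 1 / ((q;q)_i (-t;q)_i), followed by the Jacobi triple product.
   All of this is exact for suitably weighted sums truncated at N; the weights are bounded and tend
   to 1, so dominated convergence gives the value of the infinite sums. *)

Require Import Defs.
From Stdlib Require Import Reals Lra Lia ZArith FunctionalExtensionality.
From Coquelicot Require Import Coquelicot.
Open Scope C_scope.
Set Bullet Behavior "Strict Subproofs".

(** Because 1 / (q;q)_z is set to 0 for z < 0, terms outside the natural range vanish by themselves,
    and a box of side N can be reindexed by m = 2i + j or n = i + j without boundary terms. Every
    finite identity then reduces to a first-order recurrence. The Bailey pairs are written as sums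
    over all integers r, so that after two steps the alpha-sequence is itself the general term of a
    triple product. The value e = 0 or 1 (pairs relative to 1 or to q) accounts for the linear terms
    in the exponents. Neither value admits an induction of its own: the pair for (e, n) = (1, n)
    comes from (0, n), and (0, n + 1) comes from (1, n), so the two are climbed alternately. The
    theta products have modulus q^6 or q^12, whereas the sums have base q or q^2. The finite triple
    product therefore never matches the finite Bailey sum term by term; the two can only be compared
    in the limit, where both kernels become constant. *)

Lemma Cmult_cancel_l (c a b : C) : c <> 0 -> c * a = c * b -> a = b.
Proof.
  intros Hc H. replace a with (/ c * (c * a)) by now field.
  rewrite H. now field.
Qed.

(** * Finite sums, one-sided and bilateral *)

Lemma csum_ext N f g : (forall n, (n <= N)%nat -> f n = g n) -> csum N f = csum N g.
Proof.
  induction N as [|N IH]; intros H; simpl; [now apply H|].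
  rewrite IH by (intros; apply H; lia). now rewrite H by lia.
Qed.

Lemma csum_plus N f g : csum N (fun n => f n + g n) = csum N f + csum N g.
Proof. induction N as [|N IH]; simpl; [reflexivity|rewrite IH; ring]. Qed.

Lemma csum_scal N c f : csum N (fun n => c * f n) = c * csum N f.
Proof. induction N as [|N IH]; simpl; [reflexivity|rewrite IH; ring]. Qed.

Lemma csum_swap N M (f : nat -> nat -> C) :
  csum N (fun i => csum M (fun j => f i j)) = csum M (fun j => csum N (fun i => f i j)).
Proof.
  induction N as [|N IH]; simpl; [reflexivity|].
  now rewrite IH, <- csum_plus.
Qed.

Lemma csum_zero N (f : nat -> C) : (forall n, (n <= N)%nat -> f n = 0) -> csum N f = 0.
Proof.
  induction N as [|N IH]; intros H; simpl; [now apply H|].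
  rewrite IH by (intros; apply H; lia). rewrite H by lia. ring.
Qed.

Lemma csum_only_first N (f : nat -> C) : (forall n, (0 < n)%nat -> f n = 0) -> csum N f = f 0%nat.
Proof.
  intros H. induction N as [|N IH]; simpl; [reflexivity|].
  rewrite IH, (H (S N)) by lia. ring.
Qed.

Lemma csum_trunc M N (f : nat -> C) : (M <= N)%nat -> (forall n, (M < n)%nat -> f n = 0) ->
  csum N f = csum M f.
Proof.
  intros HMN H. induction HMN as [|N HMN IH]; simpl; [reflexivity|].
  rewrite IH, (H (S N)) by lia. ring.
Qed.

(** The vanishing of [F] beyond [N] pads the shorter range, so the upper limit stays [N]. Changes of
    variable such as n = i + j thus become equalities of sums over one and the same box. *)
Lemma csum_shift d N (F : nat -> C) :
  (forall n, (n < d)%nat -> F n = 0) -> (forall n, (N < n)%nat -> F n = 0) ->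
  csum N (fun j => F (d + j)%nat) = csum N F.
Proof.
  intros H1 H2.
  rewrite <- (csum_trunc N (d + N) F) by (assumption || lia).
  clear H2. induction N as [|N IH]; simpl.
  - rewrite Nat.add_0_r. destruct d as [|d]; simpl; [reflexivity|].
    rewrite csum_zero by (intros; apply H1; lia). ring.
  - rewrite IH, Nat.add_succ_r. reflexivity.
Qed.

(** Pairing r with -r presents a bilateral sum as a one-sided series, to which the facts about
    [csum] and dominated convergence apply. *)
Definition zfold (f : Z -> C) (n : nat) : C :=
  match n with
  | O => f 0%Z
  | S _ => f (Z.of_nat n) + f (- Z.of_nat n)%Z
  end.

Definition zsum (N : nat) (f : Z -> C) : C := csum N (zfold f).

Lemma zsum_ext N f g : (forall r, f r = g r) -> zsum N f = zsum N g.
Proof.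
  intros H. apply csum_ext. intros [|n] _; unfold zfold; now rewrite ?H.
Qed.

Lemma zsum_plus N f g : zsum N (fun r => f r + g r) = zsum N f + zsum N g.
Proof.
  unfold zsum. rewrite <- csum_plus. apply csum_ext.
  intros [|n] _; unfold zfold; ring.
Qed.

Lemma zsum_scal N c f : zsum N (fun r => c * f r) = c * zsum N f.
Proof.
  unfold zsum. rewrite <- csum_scal. apply csum_ext.
  intros [|n] _; unfold zfold; ring.
Qed.

Lemma zsum_csum_swap N M (f : nat -> Z -> C) :
  csum N (fun i => zsum M (f i)) = zsum M (fun r => csum N (fun i => f i r)).
Proof.
  unfold zsum. rewrite csum_swap. apply csum_ext.
  intros [|n] _; unfold zfold; [reflexivity|apply csum_plus].
Qed.

Lemma zsum_opp N f : zsum N (fun r => f (- r)%Z) = zsum N f.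
Proof.
  apply csum_ext. intros [|n] _; unfold zfold; [reflexivity|].
  rewrite Z.opp_involutive. ring.
Qed.

(** The window from -N to N moves by one, gaining f(N + 1) and losing f(-N); for the finitely
    supported kernels below both are 0. *)
Lemma zsum_shift N (f : Z -> C) : f (Z.of_nat N + 1)%Z = 0 -> f (- Z.of_nat N)%Z = 0 ->
  zsum N (fun r => f (r + 1)%Z) = zsum N f.
Proof.
  intros H1 H2.
  assert (E : zsum N (fun r => f (r + 1)%Z)
    = zsum N f + f (Z.of_nat N + 1)%Z - f (- Z.of_nat N)%Z).
  { clear. induction N as [|N IH]; unfold zsum in *; [simpl; ring|].
    cbn [csum]. rewrite IH. unfold zfold.
    replace (Z.of_nat (S N) + 1)%Z with (Z.of_nat N + 2)%Z by lia.
    replace (- Z.of_nat (S N) + 1)%Z with (- Z.of_nat N)%Z by lia.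
    replace (Z.of_nat (S N)) with (Z.of_nat N + 1)%Z by lia. ring. }
  rewrite E, H1, H2. ring.
Qed.

Lemma zsum_only_zero N (f : Z -> C) : (forall r, r <> 0%Z -> f r = 0) -> zsum N f = f 0%Z.
Proof.
  intros H. unfold zsum. rewrite csum_only_first; [reflexivity|].
  intros [|n] Hn; [lia|]. unfold zfold. rewrite !H by lia. ring.
Qed.

(** * Integer powers and finite q-Pochhammer symbols *)

Definition zpow (q : C) (z : Z) : C :=
  if (0 <=? z)%Z then q ^ Z.to_nat z else / (q ^ Z.to_nat (- z)).

Lemma zpow_nonneg (q : C) z : (0 <= z)%Z -> zpow q z = q ^ Z.to_nat z.
Proof. intros H. unfold zpow. now rewrite (proj2 (Z.leb_le _ _) H). Qed.

Lemma zpow_nat (q : C) n : zpow q (Z.of_nat n) = q ^ n.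
Proof. rewrite zpow_nonneg by lia. now rewrite Nat2Z.id. Qed.

Lemma zpow_0 q : zpow q 0 = 1.
Proof. reflexivity. Qed.

Lemma zpow_1 q : zpow q 1 = q.
Proof. rewrite zpow_nonneg by lia. simpl. ring. Qed.

Lemma zpow_opp (q : C) z : q <> 0 -> zpow q (- z) = / zpow q z.
Proof.
  intros Hq. unfold zpow.
  destruct (Z.leb_spec 0 z), (Z.leb_spec 0 (- z)); try lia.
  - replace z with 0%Z by lia. simpl. field.
  - now rewrite Z.opp_involutive.
  - field. now apply Cpow_nz.
Qed.

Lemma zpow_add (q : C) a b : q <> 0 -> zpow q (a + b) = zpow q a * zpow q b.
Proof.
  intros Hq.
  assert (S1 : forall z, zpow q (z + 1) = zpow q z * q).
  { intros z. unfold zpow.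
    destruct (Z.leb_spec 0 z), (Z.leb_spec 0 (z + 1)); try lia.
    - rewrite Z2Nat.inj_add, Cpow_add_r by lia. simpl. ring.
    - replace z with (-1)%Z by lia. simpl. field. assumption.
    - replace (- z)%Z with (- (z + 1) + 1)%Z by lia.
      rewrite Z2Nat.inj_add, Cpow_add_r by lia. simpl. field.
      split; [assumption|now apply Cpow_nz]. }
  revert b. apply Z.bi_induction.
  - now intros x y ->.
  - rewrite Z.add_0_r, zpow_0. ring.
  - intros b. unfold Z.succ. rewrite Z.add_assoc, !S1. split; intros H.
    + rewrite H. ring.
    + replace (zpow q (a + b)) with (zpow q (a + b) * q * / q) by now field.
      rewrite H. now field.
Qed.

Lemma zpow_nz (q : C) z : q <> 0 -> zpow q z <> 0.
Proof.
  intros Hq H. apply C1_nz.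
  assert (E : zpow q (z + - z) = 1) by (rewrite Z.add_opp_diag_r; reflexivity).
  rewrite zpow_add, H in E by assumption. rewrite <- E. ring.
Qed.

Lemma zpow_pow (q : C) m z : q <> 0 -> zpow (q ^ m) z = zpow q (Z.of_nat m * z).
Proof.
  intros Hq. unfold zpow.
  destruct (Z.leb_spec 0 z), (Z.leb_spec 0 (Z.of_nat m * z)); try nia.
  - rewrite <- Cpow_mult_r. f_equal. nia.
  - assert (m = 0)%nat by nia. subst. rewrite Z.mul_0_l. simpl.
    rewrite Cpow_1_l. field.
  - rewrite <- Cpow_mult_r. do 2 f_equal. nia.
Qed.

Lemma C_neq_1_of_Cmod x : (Cmod x < 1)%R -> 1 - x <> 0.
Proof.
  intros H E. assert (x = 1) as -> by (rewrite <- (Cplus_0_l x), <- E; ring).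
  rewrite Cmod_1 in H. lra.
Qed.

Lemma Cmod_pow_lt_1 q n : (Cmod q < 1)%R -> (0 < n)%nat -> (Cmod (q ^ n) < 1)%R.
Proof.
  intros Hq Hn. rewrite Cmod_pow. destruct n; [lia|].
  apply pow_lt_1_compat; [split; [apply Cmod_ge_0|assumption]|lia].
Qed.

Lemma Cmod_pow_le_1 q n : (Cmod q <= 1)%R -> (Cmod (q ^ n) <= 1)%R.
Proof.
  intros Hq. rewrite Cmod_pow, <- (pow1 n). apply pow_incr.
  split; [apply Cmod_ge_0|assumption].
Qed.

Lemma Cmod_mult_lt_1 a b : (Cmod a < 1)%R -> (Cmod b <= 1)%R -> (Cmod (a * b) < 1)%R.
Proof.
  intros Ha Hb. rewrite Cmod_mult.
  pose proof (Cmod_ge_0 a). pose proof (Cmod_ge_0 b). nra.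
Qed.

Lemma qpoch_nz a q n : (Cmod a < 1)%R -> (Cmod q < 1)%R -> qpoch a q n <> 0.
Proof.
  intros Ha Hq. induction n as [|n IH]; simpl; [apply C1_nz|].
  apply Cmult_neq_0; [assumption|].
  apply C_neq_1_of_Cmod, Cmod_mult_lt_1; [assumption|].
  apply Cmod_pow_le_1. lra.
Qed.

Lemma qpoch_add a q m n : qpoch a q (m + n) = qpoch a q m * qpoch (a * q ^ m) q n.
Proof.
  induction n as [|n IH]; [rewrite Nat.add_0_r; cbn [qpoch]; ring|].
  rewrite Nat.add_succ_r. simpl. rewrite IH, Cpow_add_r. ring.
Qed.

(** At a = q this merges (q;q)_i from the summand with (-q;q)_i left by the sum over k into
    (q^2;q^2)_i. *)
Lemma qpoch_opp_mult a q n : qpoch a q n * qpoch (- a) q n = qpoch (a ^ 2) (q ^ 2) n.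
Proof.
  induction n as [|n IH]; cbn [qpoch]; [ring|].
  rewrite <- IH, <- Cpow_mult_r, Nat.mul_comm, Cpow_mult_r. ring.
Qed.

(* [1 / (q;q)_z], with the usual convention that it vanishes for negative [z] *)
Definition iqpoch (q : C) (z : Z) : C :=
  if (z <? 0)%Z then 0 else / qpoch q q (Z.to_nat z).

Lemma iqpoch_neg q z : (z < 0)%Z -> iqpoch q z = 0.
Proof. intros H. unfold iqpoch. now rewrite (proj2 (Z.ltb_lt _ _) H). Qed.

Lemma iqpoch_nat q n : iqpoch q (Z.of_nat n) = / qpoch q q n.
Proof.
  unfold iqpoch. rewrite (proj2 (Z.ltb_ge _ _)) by lia. now rewrite Nat2Z.id.
Qed.

Lemma iqpoch_0 q : iqpoch q 0 = 1.
Proof. unfold iqpoch. simpl. field. Qed.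

(** At n = 0 both sides vanish by the convention for negative arguments, so recurrences built on
    this step have no boundary cases. *)
Lemma iqpoch_step q n : (Cmod q < 1)%R ->
  (1 - q ^ n) * iqpoch q (Z.of_nat n) = iqpoch q (Z.of_nat n - 1).
Proof.
  intros Hq. destruct n as [|n].
  - rewrite (iqpoch_neg q (Z.of_nat 0 - 1)) by lia. simpl. ring.
  - replace (Z.of_nat (S n) - 1)%Z with (Z.of_nat n) by lia.
    rewrite !iqpoch_nat. simpl. field.
    split; [now apply qpoch_nz|].
    apply (C_neq_1_of_Cmod (q ^ S n)), Cmod_pow_lt_1; [assumption|lia].
Qed.

Lemma iqpoch_pred (q : C) z : (Cmod q < 1)%R -> q <> 0 ->
  iqpoch q (z - 1) = (1 - zpow q z) * iqpoch q z.
Proof.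
  intros Hq H0. destruct (Z_lt_le_dec z 0).
  - rewrite !iqpoch_neg by lia. ring.
  - rewrite <- (Z2Nat.id z) by assumption. rewrite zpow_nat.
    now rewrite iqpoch_step.
Qed.

(** * Finite q-binomial summations *)

Lemma triangle_succ k : (S k * (S k - 1) / 2 = k * (k - 1) / 2 + k)%nat.
Proof.
  replace (S k * (S k - 1))%nat with (k * (k - 1) + k * 2)%nat by nia.
  apply Nat.div_add. lia.
Qed.

(* Splitting [1 - q^N = (1 - q^(N-k)) + q^(N-k) (1 - q^k)] gives a first-order recurrence in [N]. *)
Lemma finite_euler q x N : (Cmod q < 1)%R ->
  csum N (fun k => x ^ k * q ^ (k * (k - 1) / 2)
                     * iqpoch q (Z.of_nat k) * iqpoch q (Z.of_nat N - Z.of_nat k))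
  = qpoch (- x) q N * iqpoch q (Z.of_nat N).
Proof.
  intros Hq.
  (* The upper limit is decoupled from [N], so that the sums for N and N + 1 are compared over a
     common range. *)
  enough (H : forall M, (N <= M)%nat ->
    csum M (fun k => x ^ k * q ^ (k * (k - 1) / 2)
                     * iqpoch q (Z.of_nat k) * iqpoch q (Z.of_nat N - Z.of_nat k))
    = qpoch (- x) q N * iqpoch q (Z.of_nat N)) by now apply H.
  induction N as [|N IH]; intros M HM.
  - rewrite csum_only_first.
    + simpl. rewrite iqpoch_0. ring.
    + intros n Hn. rewrite (iqpoch_neg q (Z.of_nat 0 - _)) by lia. ring.
  - assert (Hz : 1 - q ^ S N <> 0).
    { apply C_neq_1_of_Cmod, Cmod_pow_lt_1; [assumption|lia]. }
    set (t := fun k => x ^ k * q ^ (k * (k - 1) / 2)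
                     * iqpoch q (Z.of_nat k) * iqpoch q (Z.of_nat N - Z.of_nat k)).
    set (F := fun k => x ^ k * q ^ (k * (k - 1) / 2) * q ^ (S N - k)
             * iqpoch q (Z.of_nat k - 1) * iqpoch q (Z.of_nat (S N) - Z.of_nat k)).
    (* The second part of the splitting, reindexed by one, is x q^N times the sum for N; together
       with the first part it yields the new factor 1 + x q^N. *)
    assert (HF : csum M F = x * q ^ N * csum M t).
    { rewrite <- (csum_shift 1 M F), <- csum_scal.
      - apply csum_ext. intros k Hk. unfold F, t.
        destruct (Nat.le_gt_cases k N).
        + replace (Z.of_nat (1 + k) - 1)%Z with (Z.of_nat k) by lia.
          replace (Z.of_nat (S N) - Z.of_nat (1 + k))%Z with (Z.of_nat N - Z.of_nat k)%Z by lia.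
          change (1 + k)%nat with (S k). rewrite triangle_succ, Cpow_add_r.
          replace (q ^ N) with (q ^ k * q ^ (S N - S k)); [simpl; ring|].
          rewrite <- Cpow_add_r. f_equal. lia.
        + rewrite !(iqpoch_neg q (Z.of_nat _ - Z.of_nat _)) by lia. ring.
      - intros n Hn. unfold F. rewrite (iqpoch_neg q (Z.of_nat n - 1)) by lia. ring.
      - intros n Hn. unfold F. rewrite (iqpoch_neg q (Z.of_nat (S N) - _)) by lia. ring. }
    assert (E : (1 - q ^ S N) * csum M (fun k => x ^ k * q ^ (k * (k - 1) / 2)
        * iqpoch q (Z.of_nat k) * iqpoch q (Z.of_nat (S N) - Z.of_nat k))
        = csum M t + csum M F).
    { rewrite <- csum_scal, <- csum_plus. apply csum_ext. intros k Hk. unfold t, F.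
      destruct (Nat.le_gt_cases k (S N)).
      - rewrite <- iqpoch_step by assumption.
        replace (Z.of_nat N - Z.of_nat k)%Z with (Z.of_nat (S N - k) - 1)%Z by lia.
        rewrite <- iqpoch_step by assumption.
        replace (Z.of_nat (S N) - Z.of_nat k)%Z with (Z.of_nat (S N - k))%Z by lia.
        replace (q ^ S N) with (q ^ k * q ^ (S N - k)); [ring|].
        rewrite <- Cpow_add_r. f_equal. lia.
      - rewrite !(iqpoch_neg q (Z.of_nat _ - Z.of_nat _)) by lia. ring. }
    unfold t in E at 1. rewrite HF in E. unfold t in E. rewrite IH in E by lia.
    apply (Cmult_cancel_l (1 - q ^ S N)); [assumption|].
    rewrite E. replace (Z.of_nat N) with (Z.of_nat (S N) - 1)%Z by lia.
    rewrite <- iqpoch_step by assumption. simpl. ring.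
Qed.

(** A limiting case of the q-Chu-Vandermonde sum. Splitting 1 - q^(M+1) = (1 - q^m) + q^m (1 -
    q^(M+1-m)) reduces M + 1 with parameter c to M with parameter c + 1, hence the induction for all
    [c] at once. *)
Lemma finite_vandermonde q M c N : (Cmod q < 1)%R -> (M <= N)%nat ->
  csum N (fun m => q ^ (m * m + c * m) * iqpoch q (Z.of_nat M - Z.of_nat m)
                     * iqpoch q (Z.of_nat m) * iqpoch q (Z.of_nat (m + c)))
  = iqpoch q (Z.of_nat M) * iqpoch q (Z.of_nat (M + c)).
Proof.
  intros Hq. revert c. induction M as [|M IH]; intros c HM.
  - rewrite csum_only_first.
    + simpl. rewrite Nat.mul_0_r. simpl. rewrite iqpoch_0. ring.
    + intros n Hn. rewrite (iqpoch_neg q (Z.of_nat 0 - _)) by lia. ring.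
  - assert (Hz : 1 - q ^ S M <> 0).
    { apply C_neq_1_of_Cmod, Cmod_pow_lt_1; [assumption|lia]. }
    set (F := fun m => q ^ (m * m + c * m) * iqpoch q (Z.of_nat (S M) - Z.of_nat m)
                     * iqpoch q (Z.of_nat m - 1) * iqpoch q (Z.of_nat (m + c))).
    apply (Cmult_cancel_l (1 - q ^ S M)); [assumption|].
    rewrite Cmult_assoc, iqpoch_step by assumption.
    replace (Z.of_nat (S M) - 1)%Z with (Z.of_nat M) by lia.
    replace (S M + c)%nat with (M + S c)%nat by lia.
    rewrite <- IH by lia.
    rewrite <- csum_scal.
    transitivity (csum N (fun m => q ^ (m * m + S c * m) * (1 - q ^ (m + S c))
       * iqpoch q (Z.of_nat M - Z.of_nat m) * iqpoch q (Z.of_nat m)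
       * iqpoch q (Z.of_nat (m + S c))) + csum N F).
    + rewrite <- csum_plus. apply csum_ext. intros m Hm. unfold F.
      destruct (Nat.le_gt_cases m (S M)).
      * rewrite <- iqpoch_step by assumption.
        replace (Z.of_nat (m + c)) with (Z.of_nat (m + S c) - 1)%Z by lia.
        rewrite <- iqpoch_step by assumption.
        replace (Z.of_nat M - Z.of_nat m)%Z with (Z.of_nat (S M - m) - 1)%Z by lia.
        rewrite <- iqpoch_step by assumption.
        replace (Z.of_nat (S M) - Z.of_nat m)%Z with (Z.of_nat (S M - m))%Z by lia.
        replace (q ^ S M) with (q ^ m * q ^ (S M - m)).
        2: { rewrite <- Cpow_add_r. f_equal. lia. }
        replace (m * m + S c * m)%nat with (m * m + c * m + m)%nat by lia.
        rewrite (Cpow_add_r q (m * m + c * m) m). ring.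
      * rewrite !(iqpoch_neg q (Z.of_nat _ - Z.of_nat _)) by lia. ring.
    (* Shifted by one, [F] restores the term with q^(m+c+1) that the factor 1 - q^(m+c+1) in the
       other sum takes away. *)
    + rewrite <- (csum_shift 1 N F).
      * rewrite <- csum_plus. apply csum_ext. intros m Hm. unfold F.
        replace (Z.of_nat (S M) - Z.of_nat (1 + m))%Z with (Z.of_nat M - Z.of_nat m)%Z by lia.
        replace (Z.of_nat (1 + m) - 1)%Z with (Z.of_nat m) by lia.
        replace (1 + m + c)%nat with (m + S c)%nat by lia.
        replace ((1 + m) * (1 + m) + c * (1 + m))%nat with ((m * m + S c * m) + (m + S c))%nat by lia.
        rewrite (Cpow_add_r q (m * m + S c * m) (m + S c)). ring.
      * intros n Hn. unfold F. rewrite (iqpoch_neg q (Z.of_nat n - 1)) by lia. ring.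
      * intros n Hn. unfold F. rewrite (iqpoch_neg q (Z.of_nat (S M) - _)) by lia. ring.
Qed.

(* For negative [r] the reflection [r -> - r - e] exchanges the last two factors and preserves [r^2 + e r]. *)
Lemma bailey_step (q : C) (e n N : nat) (r : Z) : (Cmod q < 1)%R -> (n <= N)%nat -> (e <= 1)%nat ->
  csum N (fun i => q ^ (i * i + e * i) * iqpoch q (Z.of_nat n - Z.of_nat i)
     * (iqpoch q (Z.of_nat i - r) * iqpoch q (Z.of_nat i + r + Z.of_nat e)))
  = zpow q (r * r + Z.of_nat e * r)
     * (iqpoch q (Z.of_nat n - r) * iqpoch q (Z.of_nat n + r + Z.of_nat e)).
Proof.
  intros Hq HN He.
  assert (P : forall r, (0 <= r)%Z ->
    csum N (fun i => q ^ (i * i + e * i) * iqpoch q (Z.of_nat n - Z.of_nat i)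
     * (iqpoch q (Z.of_nat i - r) * iqpoch q (Z.of_nat i + r + Z.of_nat e)))
    = zpow q (r * r + Z.of_nat e * r)
     * (iqpoch q (Z.of_nat n - r) * iqpoch q (Z.of_nat n + r + Z.of_nat e))).
  { clear r. intros z Hz. rewrite <- (Z2Nat.id z Hz). set (r := Z.to_nat z). clearbody r. clear z Hz.
    destruct (Nat.le_gt_cases r n) as [Hr|Hr].
    (* With i = r + m the exponent i^2 + e i splits into r^2 + e r and m^2 + (2r + e) m, which is
       [finite_vandermonde] with c = 2r + e. *)
    - rewrite <- (csum_shift r).
      2: { intros i Hi. rewrite (iqpoch_neg q (Z.of_nat i - Z.of_nat r)) by lia. ring. }
      2: { intros i Hi. rewrite (iqpoch_neg q (Z.of_nat n - Z.of_nat i)) by lia. ring. }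
      replace (Z.of_nat n - Z.of_nat r)%Z with (Z.of_nat (n - r)) by lia.
      replace (Z.of_nat n + Z.of_nat r + Z.of_nat e)%Z with (Z.of_nat (n - r + (2 * r + e))) by lia.
      rewrite <- finite_vandermonde with (N := N) by (assumption || lia).
      rewrite <- csum_scal. apply csum_ext. intros m Hm.
      replace (Z.of_nat r * Z.of_nat r + Z.of_nat e * Z.of_nat r)%Z with (Z.of_nat (r * r + e * r)) by lia.
      rewrite zpow_nat.
      replace (Z.of_nat n - Z.of_nat (r + m))%Z with (Z.of_nat (n - r) - Z.of_nat m)%Z by lia.
      replace (Z.of_nat (r + m) - Z.of_nat r)%Z with (Z.of_nat m) by lia.
      replace (Z.of_nat (r + m) + Z.of_nat r + Z.of_nat e)%Z with (Z.of_nat (m + (2 * r + e))) by lia.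
      replace ((r + m) * (r + m) + e * (r + m))%nat
        with ((r * r + e * r) + (m * m + (2 * r + e) * m))%nat by lia.
      rewrite (Cpow_add_r q (r * r + e * r)). ring.
    - rewrite (iqpoch_neg q (Z.of_nat n - Z.of_nat r)) by lia.
      rewrite csum_zero; [ring|]. intros i Hi. destruct (Nat.le_gt_cases i n).
      + rewrite (iqpoch_neg q (Z.of_nat i - Z.of_nat r)) by lia. ring.
      + rewrite (iqpoch_neg q (Z.of_nat n - Z.of_nat i)) by lia. ring. }
  (* Since e <= 1, the reflection sends every negative r to some - r - e >= 0, where [P] applies. *)
  destruct (Z_le_gt_dec 0 r) as [Hr|Hr]; [now apply P|].
  assert (Hs : (0 <= - r - Z.of_nat e)%Z) by lia.
  specialize (P _ Hs).
  replace ((- r - Z.of_nat e) * (- r - Z.of_nat e) + Z.of_nat e * (- r - Z.of_nat e))%Z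
    with (r * r + Z.of_nat e * r)%Z in P by ring.
  replace (Z.of_nat n - (- r - Z.of_nat e))%Z with (Z.of_nat n + r + Z.of_nat e)%Z in P by ring.
  replace (Z.of_nat n + (- r - Z.of_nat e) + Z.of_nat e)%Z with (Z.of_nat n - r)%Z in P by ring.
  rewrite (Cmult_comm (iqpoch q (Z.of_nat n - r))), <- P.
  apply csum_ext. intros i Hi.
  replace (Z.of_nat i - (- r - Z.of_nat e))%Z with (Z.of_nat i + r + Z.of_nat e)%Z by ring.
  replace (Z.of_nat i + (- r - Z.of_nat e) + Z.of_nat e)%Z with (Z.of_nat i - r)%Z by ring.
  ring.
Qed.

(* The generating function in [t] of the left-hand side is [(-t;q)_oo / (t^2;q^2)_oo = 1 / (t;q)_oo]. *)
Lemma two_step_sum q m N : (Cmod q < 1)%R -> (m <= N)%nat ->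
  csum N (fun i => q ^ ((m - 2 * i) * (m - 2 * i - 1) / 2)
     * iqpoch q (Z.of_nat m - 2 * Z.of_nat i) * iqpoch (q ^ 2) (Z.of_nat i))
  = iqpoch q (Z.of_nat m).
Proof.
  intros Hq Hm.
  assert (Hq2 : (Cmod (q ^ 2) < 1)%R) by (apply Cmod_pow_lt_1; [assumption|lia]).
  set (a := fun z => q ^ (Z.to_nat z * (Z.to_nat z - 1) / 2) * iqpoch q z).
  set (a' := fun z => q ^ Z.to_nat z * a z).
  set (b := fun i => iqpoch (q ^ 2) (Z.of_nat i)).
  set (c := fun z => csum N (fun i => a (z - 2 * Z.of_nat i)%Z * b i)).
  set (d := fun z => csum N (fun i => a' (z - 2 * Z.of_nat i)%Z * b i)).
  assert (neg : forall z, (z < 0)%Z -> a' z = 0).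
  { intros z Hz. unfold a', a. rewrite iqpoch_neg by assumption. ring. }
  (* Coefficient form of (-t;q)_oo = (1 + t) (-tq;q)_oo: [a] and [a'] are the coefficients of these
     two products. *)
  assert (Ha : forall z, a z = a' z + a' (z - 1)%Z).
  { intros z. destruct (Z_lt_le_dec z 0) as [Hz|Hz].
    - rewrite !neg by lia. unfold a. rewrite iqpoch_neg by assumption. ring.
    - destruct (Z.eq_dec z 0) as [->|Hz0].
      + rewrite (neg (0 - 1)%Z) by lia. unfold a'. simpl. ring.
      + assert (E : exists k, z = Z.of_nat (S k)) by (exists (Z.to_nat (z - 1)); lia).
        destruct E as [k ->]. unfold a', a. rewrite <- iqpoch_step by assumption.
        replace (Z.of_nat (S k) - 1)%Z with (Z.of_nat k) by lia.
        rewrite !Nat2Z.id, triangle_succ, Cpow_add_r. ring. }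
  assert (Hcd : forall z, c z = d z + d (z - 1)%Z).
  { intros z. unfold c, d. rewrite <- csum_plus. apply csum_ext. intros i _.
    rewrite Ha. replace (z - 1 - 2 * Z.of_nat i)%Z with (z - 2 * Z.of_nat i - 1)%Z by ring. ring. }
  enough (H : c (Z.of_nat m) = iqpoch q (Z.of_nat m)).
  { rewrite <- H. apply csum_ext. intros i _. unfold a, b.
    replace (Z.to_nat (Z.of_nat m - 2 * Z.of_nat i)) with (m - 2 * i)%nat by lia. reflexivity. }
  induction m as [|m IH].
  - unfold c. rewrite csum_only_first.
    + unfold a, b. simpl. rewrite !iqpoch_0. ring.
    + intros n Hn. unfold a. rewrite (iqpoch_neg q) by lia. ring.
  - assert (Hz : 1 - q ^ S m <> 0).
    { apply C_neq_1_of_Cmod, Cmod_pow_lt_1; [assumption|lia]. }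
    apply (Cmult_cancel_l (1 - q ^ S m)); [assumption|].
    rewrite iqpoch_step by assumption.
    replace (Z.of_nat (S m) - 1)%Z with (Z.of_nat m) by lia.
    rewrite <- IH, (Hcd (Z.of_nat m)) by lia.
    (* The factor 1 - q^(2i) lowers the index of [b], which multiplies the generating function D of
       [d] by t^2. With C = (1 + t) D for [c], the recurrence is C(t) - C(qt) = (t + t^2) D(t) = t
       C(t). *)
    set (F := fun i => a' (Z.of_nat (S m) - 2 * Z.of_nat i)%Z * iqpoch (q ^ 2) (Z.of_nat i - 1)).
    assert (HF : csum N F = d (Z.of_nat m - 1)%Z).
    { rewrite <- (csum_shift 1 N F).
      - apply csum_ext. intros i _. unfold F, b.
        replace (Z.of_nat (S m) - 2 * Z.of_nat (1 + i))%Z with (Z.of_nat m - 1 - 2 * Z.of_nat i)%Z by lia.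
        replace (Z.of_nat (1 + i) - 1)%Z with (Z.of_nat i) by lia. reflexivity.
      - intros n Hn. unfold F. rewrite iqpoch_neg by lia. ring.
      - intros n Hn. unfold F. rewrite neg by lia. ring. }
    rewrite <- HF. unfold c, d.
    rewrite <- csum_scal, <- csum_plus. apply csum_ext. intros i _. unfold F, b.
    rewrite <- iqpoch_step by assumption.
    replace (Z.of_nat m - 2 * Z.of_nat i)%Z with (Z.of_nat (S m) - 2 * Z.of_nat i - 1)%Z by lia.
    set (z := (Z.of_nat (S m) - 2 * Z.of_nat i)%Z).
    destruct (Z_lt_le_dec z 0) as [Hz0|Hz0].
    + rewrite !neg by lia. unfold a. rewrite iqpoch_neg by assumption. ring.
    + replace (a' (z - 1)%Z) with (a z - a' z) by (rewrite (Ha z); ring).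
      unfold a'. replace (q ^ S m) with (q ^ Z.to_nat z * (q ^ 2) ^ i); [ring|].
      rewrite <- Cpow_mult_r, <- Cpow_add_r. f_equal. unfold z. lia.
Qed.

(** * The finite Jacobi triple product *)

Lemma triangle_succ_Z r : ((r + 1) * (r + 2) / 2 = r * (r + 1) / 2 + (r + 1))%Z.
Proof.
  replace ((r + 1) * (r + 2))%Z with (r * (r + 1) + (r + 1) * 2)%Z by ring.
  apply Z.div_add. lia.
Qed.

Lemma m1_nz : - (1) <> 0 :> C.
Proof. intros H. apply C1_nz. replace (RtoC 1) with (- - (1)) by ring. rewrite H. ring. Qed.

(** The general term of Ramanujan's theta function f(-u, -v) = (u;uv)_oo (v;uv)_oo (uv;uv)_oo. Both
    divisions by 2 are exact. *)
Definition theta_coeff (u v : C) (r : Z) : C :=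
  zpow (- (1)) r * zpow u (r * (r + 1) / 2) * zpow v (r * (r - 1) / 2).

Lemma theta_coeff_succ (u v : C) r : u <> 0 -> v <> 0 ->
  theta_coeff u v (r + 1) = - (zpow u (r + 1) * zpow v r * theta_coeff u v r).
Proof.
  intros Hu Hv. unfold theta_coeff.
  replace (r + 1 + 1)%Z with (r + 2)%Z by ring.
  replace (r + 1 - 1)%Z with r by ring.
  pose proof (triangle_succ_Z r) as E. pose proof (triangle_succ_Z (r - 1)) as E'.
  replace (r - 1 + 1)%Z with r in E' by ring. replace (r - 1 + 2)%Z with (r + 1)%Z in E' by ring.
  replace ((r - 1) * r)%Z with (r * (r - 1))%Z in E' by ring.
  replace ((r + 1) * r)%Z with (r * (r + 1))%Z by ring.
  rewrite E, (zpow_add u), E', (zpow_add v), zpow_add, zpow_1 by (assumption || apply m1_nz).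
  ring.
Qed.

Lemma zpow_mult_l (u v : C) z : u <> 0 -> v <> 0 -> zpow (u * v) z = zpow u z * zpow v z.
Proof.
  intros Hu Hv. unfold zpow. destruct (Z.leb_spec 0 z); rewrite Cpow_mult_l; [reflexivity|].
  field. split; now apply Cpow_nz.
Qed.

Lemma zpow_succ (q : C) z : q <> 0 -> zpow q (z + 1) = zpow q z * q.
Proof. intros H. now rewrite zpow_add, zpow_1. Qed.

Lemma zpow_sub (q : C) a b : q <> 0 -> zpow q (a - b) = zpow q a / zpow q b.
Proof. intros H. unfold Z.sub. now rewrite zpow_add, zpow_opp. Qed.

(* Both sides satisfy the same first-order recurrence in [N]: the factor [(1 - u P^N)(1 - v P^N)] acts on the coefficients by the shifts [r -> r + 1] and [r -> r - 1]. *)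
Lemma finite_jacobi (u v : C) N M : u <> 0 -> v <> 0 -> (Cmod (u * v) < 1)%R -> (N < M)%nat ->
  qpoch (u * v) (u * v) (2 * N)
    * zsum M (fun r => theta_coeff u v r
                * (iqpoch (u * v) (Z.of_nat N - r) * iqpoch (u * v) (Z.of_nat N + r)))
  = qpoch u (u * v) N * qpoch v (u * v) N.
Proof.
  intros Hu Hv HP. set (P := u * v) in *.
  assert (H0 : P <> 0) by now apply Cmult_neq_0.
  induction N as [|N IH]; intros HM.
  - rewrite zsum_only_zero.
    + change (Z.of_nat 0 - 0)%Z with 0%Z. change (Z.of_nat 0 + 0)%Z with 0%Z.
      rewrite iqpoch_0. unfold theta_coeff. cbn -[Cmult]. ring.
    + intros r Hr. destruct (Z_lt_le_dec r 0).
      * rewrite (iqpoch_neg P (Z.of_nat 0 + r)) by lia. ring.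
      * rewrite (iqpoch_neg P (Z.of_nat 0 - r)) by lia. ring.
  - set (X := P ^ N).
    set (F := fun r => theta_coeff u v r
                * (iqpoch P (Z.of_nat N - r) * iqpoch P (Z.of_nat N + r))) in IH.
    assert (Hlo : forall r, (r < - Z.of_nat N)%Z -> F r = 0).
    { intros r Hr. unfold F. rewrite (iqpoch_neg P (Z.of_nat N + r)) by lia. ring. }
    assert (Hhi : forall r, (Z.of_nat N < r)%Z -> F r = 0).
    { intros r Hr. unfold F. rewrite (iqpoch_neg P (Z.of_nat N - r)) by lia. ring. }
    assert (E : (1 - P * X * X) * (1 - P * P * X * X) * zsum M (fun r => theta_coeff u v r
        * (iqpoch P (Z.of_nat (S N) - r) * iqpoch P (Z.of_nat (S N) + r)))
      = (1 - u * X) * (1 - v * X) * zsum M F).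
    { transitivity ((1 + P * X * X) * zsum M F + - (u * X) * zsum M (fun r => F (r - 1)%Z)
                    + - (v * X) * zsum M (fun r => F (r + 1)%Z)).
      - rewrite <- !zsum_scal, <- !zsum_plus. apply zsum_ext. intros r. unfold F.
        (* Multiplied by [v] or [u], the neighbouring coefficients differ from [theta_coeff u v r]
           only by powers of P = uv, so the termwise identity becomes rational in X = P^N and Y =
           P^r. *)
        assert (C1 : theta_coeff u v (r + 1) * v = - (P * zpow P r * theta_coeff u v r)).
        { rewrite theta_coeff_succ, zpow_succ by assumption.
          unfold P. rewrite zpow_mult_l by assumption. ring. }
        assert (C2 : zpow P r * (theta_coeff u v (r - 1) * u) = - (P * theta_coeff u v r)).
        { replace (theta_coeff u v r) with (theta_coeff u v (r - 1 + 1)) by (f_equal; ring).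
          rewrite theta_coeff_succ by assumption.
          replace (r - 1 + 1)%Z with r by ring.
          unfold P at 1. rewrite zpow_mult_l by assumption.
          replace (zpow v r) with (zpow v (r - 1) * v); [unfold P; ring|].
          rewrite <- zpow_succ by assumption. f_equal. ring. }
        set (Y := zpow P r) in *.
        assert (HY : Y <> 0) by now apply zpow_nz.
        assert (C2' : theta_coeff u v (r - 1) * u = - (P * theta_coeff u v r) / Y).
        { rewrite <- C2. now field. }
        assert (ZN : zpow P (Z.of_nat N) = X) by apply zpow_nat.
        replace (Z.of_nat N - (r - 1))%Z with (Z.of_nat (S N) - r)%Z by lia.
        replace (Z.of_nat N + (r + 1))%Z with (Z.of_nat (S N) + r)%Z by lia.
        replace (Z.of_nat N + (r - 1))%Z with (Z.of_nat (S N) + r - 1 - 1)%Z by lia.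
        replace (Z.of_nat N - (r + 1))%Z with (Z.of_nat (S N) - r - 1 - 1)%Z by lia.
        replace (Z.of_nat N - r)%Z with (Z.of_nat (S N) - r - 1)%Z by lia.
        replace (Z.of_nat N + r)%Z with (Z.of_nat (S N) + r - 1)%Z by lia.
        rewrite !iqpoch_pred by assumption.
        replace (Z.of_nat (S N) - r - 1)%Z with (Z.of_nat N - r)%Z by lia.
        replace (Z.of_nat (S N) + r - 1)%Z with (Z.of_nat N + r)%Z by lia.
        replace (Z.of_nat (S N)) with (Z.of_nat N + 1)%Z by lia.
        rewrite !zpow_sub, !zpow_add, zpow_1, ZN by assumption. fold Y.
        set (I1 := iqpoch P _). set (I2 := iqpoch P _).
        transitivity (((1 + P * X * X) * (theta_coeff u v r * ((1 - X * P / Y) * I1 * ((1 - X * P * Y) * I2)))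
          - X * (theta_coeff u v (r - 1) * u) * (I1 * ((1 - X * Y) * ((1 - X * P * Y) * I2)))
          - X * (theta_coeff u v (r + 1) * v) * ((1 - X / Y) * ((1 - X * P / Y) * I1) * I2))).
        + rewrite C1, C2'. field. assumption.
        + ring.
      - rewrite (zsum_shift M F) by first [apply Hlo; lia | apply Hhi; lia].
        rewrite <- (zsum_shift M (fun r => F (r - 1)%Z)) by first [apply Hlo; lia | apply Hhi; lia].
        rewrite (zsum_ext M (fun r => F (r + 1 - 1)%Z) F) by (intros r; f_equal; ring).
        unfold P. ring. }
    replace (2 * S N)%nat with (S (S (2 * N))) by lia. cbn [qpoch].
    assert (HX : P ^ (2 * N) = X * X).
    { unfold X. replace (2 * N)%nat with (N + N)%nat by lia. apply Cpow_add_r. }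
    rewrite Cpow_S, HX. fold X.
    transitivity (qpoch P P (2 * N) * ((1 - P * X * X) * (1 - P * P * X * X) * zsum M (fun r => theta_coeff u v r
        * (iqpoch P (Z.of_nat (S N) - r) * iqpoch P (Z.of_nat (S N) + r))))); [ring|].
    rewrite E. transitivity ((1 - u * X) * (1 - v * X) * (qpoch P P (2 * N) * zsum M F)); [ring|].
    rewrite IH by lia. ring.
Qed.

(** * Two Bailey pairs, each relative to both 1 and the base *)

(* The sequence beta_n of the Bailey pair relative to [q^e] with alpha-sequence [al], summed over all integers [r] instead of over [r >= 0]. *)
Definition bsum (q : C) (al : Z -> C) (e n M : nat) : C :=
  zsum M (fun r => al r * (iqpoch q (Z.of_nat n - r) * iqpoch q (Z.of_nat n + r + Z.of_nat e))).

Lemma bsum_0 (q : C) (al : Z -> C) M : al 0%Z = 1 -> bsum q al 0 0 M = 1.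
Proof.
  intros H. unfold bsum. rewrite zsum_only_zero.
  - change (Z.of_nat 0 - 0)%Z with 0%Z. change (Z.of_nat 0 + 0 + Z.of_nat 0)%Z with 0%Z.
    rewrite iqpoch_0, H. ring.
  - intros r Hr. destruct (Z_lt_le_dec r 0).
    + rewrite (iqpoch_neg q (Z.of_nat 0 + r + _)) by lia. ring.
    + rewrite (iqpoch_neg q (Z.of_nat 0 - r)) by lia. ring.
Qed.

Lemma bsum_vanish (q : C) (al : Z -> C) e n r : (r < - Z.of_nat n - Z.of_nat e \/ Z.of_nat n < r)%Z ->
  al r * (iqpoch q (Z.of_nat n - r) * iqpoch q (Z.of_nat n + r + Z.of_nat e)) = 0.
Proof.
  intros [H|H].
  - rewrite (iqpoch_neg q (Z.of_nat n + r + _)) by lia. ring.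
  - rewrite (iqpoch_neg q (Z.of_nat n - r)) by lia. ring.
Qed.

Lemma bsum_reflect_0 (q : C) al n M : bsum q al 0 n M = bsum q (fun r => al (- r)%Z) 0 n M.
Proof.
  unfold bsum. rewrite <- zsum_opp. apply zsum_ext. intros r.
  replace (Z.of_nat n - - r)%Z with (Z.of_nat n + r + Z.of_nat 0)%Z by lia.
  replace (Z.of_nat n + - r + Z.of_nat 0)%Z with (Z.of_nat n - r)%Z by lia. ring.
Qed.

(** For e = 1 the reflection r -> - r - 1 exchanges the two kernel factors. In particular a sequence
    that is odd under it has sum 0. *)
Lemma bsum_reflect_1 (q : C) al n M : (n + 2 <= M)%nat ->
  bsum q al 1 n M = bsum q (fun r => al (- r - 1)%Z) 1 n M.
Proof.
  intros HM. unfold bsum. rewrite <- zsum_opp.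
  rewrite <- zsum_shift by (apply bsum_vanish; lia). apply zsum_ext. intros r.
  replace (- (r + 1))%Z with (- r - 1)%Z by ring.
  replace (Z.of_nat n - (- r - 1))%Z with (Z.of_nat n + r + Z.of_nat 1)%Z by lia.
  replace (Z.of_nat n + (- r - 1) + Z.of_nat 1)%Z with (Z.of_nat n - r)%Z by lia. ring.
Qed.

Lemma bsum_ext (q : C) al al' e n M : (forall r, al r = al' r) -> bsum q al e n M = bsum q al' e n M.
Proof. intros H. apply zsum_ext. intros r. now rewrite H. Qed.

Lemma bsum_scal (q : C) c al e n M : bsum q (fun r => c * al r) e n M = c * bsum q al e n M.
Proof. unfold bsum. rewrite <- zsum_scal. apply zsum_ext. intros r. ring. Qed.

(* [1 - q^(2n+1) = (1 - q^(n+1+r)) + q^(n+1+r) (1 - q^(n-r))] *)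
Lemma bsum_down (q : C) al n M : (Cmod q < 1)%R -> q <> 0 -> (n + 2 <= M)%nat ->
  (1 - q ^ (2 * n + 1)) * bsum q al 1 n M
  = bsum q al 0 n M + q ^ n * bsum q (fun r => zpow q r * al (r - 1)%Z) 0 n M.
Proof.
  intros Hq H0 HM.
  rewrite <- (bsum_scal q (q ^ n)). unfold bsum.
  rewrite <- (zsum_shift M (fun r => q ^ n * (zpow q r * al (r - 1)%Z)
     * (iqpoch q (Z.of_nat n - r) * iqpoch q (Z.of_nat n + r + Z.of_nat 0)))).
  2, 3: apply (bsum_vanish q (fun r => q ^ n * (zpow q r * al (r - 1)%Z))); lia.
  rewrite <- zsum_scal, <- zsum_plus. apply zsum_ext. intros r.
  replace (r + 1 - 1)%Z with r by ring.
  replace (Z.of_nat n - (r + 1))%Z with (Z.of_nat n - r - 1)%Z by ring.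
  replace (Z.of_nat n + (r + 1) + Z.of_nat 0)%Z with (Z.of_nat n + r + Z.of_nat 1)%Z by lia.
  replace (Z.of_nat n + r + Z.of_nat 0)%Z with (Z.of_nat n + r + Z.of_nat 1 - 1)%Z by lia.
  rewrite !iqpoch_pred by assumption. change (Z.of_nat 1) with 1%Z.
  rewrite zpow_sub, !zpow_add, zpow_1, zpow_nat by assumption.
  replace (q ^ (2 * n + 1)) with (q ^ n * q ^ n * q).
  2: { replace (2 * n + 1)%nat with (n + n + 1)%nat by lia. rewrite !Cpow_add_r. simpl. ring. }
  field. now apply zpow_nz.
Qed.

(* [1 - q^(2n+2) = (1 - q^(n+1-r)) + q^(n+1-r) (1 - q^(n+1+r))] *)
Lemma bsum_up (q : C) al n M : (Cmod q < 1)%R -> q <> 0 -> (n + 2 <= M)%nat ->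
  (1 - q ^ (2 * n + 2)) * bsum q al 0 (S n) M
  = bsum q al 1 n M + q ^ n * bsum q (fun r => zpow q (- r) * al (r + 1)%Z) 1 n M.
Proof.
  intros Hq H0 HM.
  rewrite <- (bsum_scal q (q ^ n)). unfold bsum.
  set (g := fun r => q ^ n * (zpow q (- r) * al (r + 1)%Z)
     * (iqpoch q (Z.of_nat n - r) * iqpoch q (Z.of_nat n + r + Z.of_nat 1))).
  assert (Hg : forall r, (r < - Z.of_nat n - 1 \/ Z.of_nat n < r)%Z -> g r = 0).
  { intros r Hr. apply (bsum_vanish q (fun r => q ^ n * (zpow q (- r) * al (r + 1)%Z))). lia. }
  rewrite (zsum_ext M g (fun r => g (r + 1 - 1)%Z)) by (intros r; f_equal; ring).
  rewrite (zsum_shift M (fun r => g (r - 1)%Z)) by (apply Hg; lia).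
  rewrite <- zsum_scal, <- zsum_plus. apply zsum_ext. intros r. unfold g.
  replace (r - 1 + 1)%Z with r by ring.
  replace (Z.of_nat n - (r - 1))%Z with (Z.of_nat (S n) - r)%Z by lia.
  replace (Z.of_nat n + (r - 1) + Z.of_nat 1)%Z with (Z.of_nat (S n) + r + Z.of_nat 0 - 1)%Z by lia.
  replace (Z.of_nat n + r + Z.of_nat 1)%Z with (Z.of_nat (S n) + r + Z.of_nat 0)%Z by lia.
  replace (Z.of_nat n - r)%Z with (Z.of_nat (S n) - r - 1)%Z by lia.
  rewrite !iqpoch_pred by assumption.
  replace (- (r - 1))%Z with (1 - r)%Z by ring. change (Z.of_nat 0) with 0%Z. rewrite Z.add_0_r.
  rewrite !zpow_sub, zpow_add, zpow_1, zpow_nat by assumption.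
  replace (q ^ (2 * n + 2)) with (q ^ S n * q ^ S n) by (rewrite <- Cpow_add_r; f_equal; lia).
  rewrite Cpow_S.
  field. now apply zpow_nz.
Qed.

Lemma zpow_m1_succ r : zpow (- (1)) (r + 1) = - zpow (- (1)) r.
Proof. rewrite zpow_succ by apply m1_nz. ring. Qed.

Lemma zpow_m1_pred r : zpow (- (1)) (r - 1) = - zpow (- (1)) r.
Proof.
  replace r with (r - 1 + 1)%Z at 2 by ring. rewrite zpow_m1_succ. ring.
Qed.

Lemma zpow_m1_opp r : zpow (- (1)) (- r) = zpow (- (1)) r.
Proof.
  revert r. apply Z.bi_induction; [now intros x y ->|reflexivity|].
  intros r. rewrite Z.opp_succ, <- Z.sub_1_r, zpow_m1_pred. unfold Z.succ. rewrite zpow_m1_succ.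
  split; intros H; [now rewrite H|].
  replace (zpow (- (1)) (- r)) with (- - zpow (- (1)) (- r)) by ring. rewrite H. ring.
Qed.

Lemma one_minus_pow_nz (q : C) m : (Cmod q < 1)%R -> (0 < m)%nat -> 1 - q ^ m <> 0.
Proof. intros. now apply C_neq_1_of_Cmod, Cmod_pow_lt_1. Qed.

Lemma C_eq_opp_0 (x : C) : x = - x -> x = 0.
Proof.
  intros H. apply (Cmult_cancel_l 2).
  - intros E. apply (f_equal fst) in E. simpl in E. lra.
  - replace (2 * x) with (x + x) by ring. rewrite H at 2. ring.
Qed.

(** The terms of Gauss's theta series; as an alpha-sequence they give 1 / (q^2;q^2)_n both for e = 0
    and for e = 1. *)
Definition gauss_coeff (q : C) (r : Z) : C := zpow (- (1)) r * zpow q (r * r).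

(** Both contiguous relations turn [gauss_coeff] into multiples of its twist [al1], with terms
    (-1)^r q^(r^2+r), up to reflection. This twist is odd under r -> - r - 1, so its sum for e = 1
    is 0, and its sum for e = 0 follows from [bsum_down]. *)
Lemma bailey_pair_gauss_step (q : C) n M : (Cmod q < 1)%R -> q <> 0 -> (n + 2 <= M)%nat ->
  bsum q (gauss_coeff q) 1 n M = bsum q (gauss_coeff q) 0 n M /\
  (1 - q ^ (2 * n + 2)) * bsum q (gauss_coeff q) 0 (S n) M = bsum q (gauss_coeff q) 1 n M.
Proof.
  intros Hq H0 HM.
  set (al1 := fun r => zpow q r * gauss_coeff q r).
  assert (A1 : bsum q al1 1 n M = 0).
  { apply C_eq_opp_0. rewrite bsum_reflect_1 at 1 by assumption.
    replace (- bsum q al1 1 n M) with (- (1) * bsum q al1 1 n M) by ring.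
    rewrite <- bsum_scal. apply bsum_ext. intros r. unfold al1, gauss_coeff.
    rewrite zpow_m1_pred, zpow_m1_opp.
    transitivity (- zpow (- (1)) r * (zpow q (- r - 1) * zpow q ((- r - 1) * (- r - 1)))); [ring|].
    transitivity (- zpow (- (1)) r * (zpow q r * zpow q (r * r))); [|ring].
    rewrite <- !zpow_add by assumption. do 2 f_equal. ring. }
  (* [bsum_down] for [al1] has 0 on the left, and on the right q^r al1(r-1) is again -
     gauss_coeff(r). *)
  assert (A0 : bsum q al1 0 n M = q ^ n * bsum q (gauss_coeff q) 0 n M).
  { pose proof (bsum_down q al1 n M Hq H0 HM) as E. rewrite A1 in E.
    rewrite (bsum_ext q (fun r => zpow q r * al1 (r - 1)%Z) (fun r => - (1) * gauss_coeff q r) 0), bsum_scal in E.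
    - transitivity (bsum q al1 0 n M + q ^ n * (- (1) * bsum q (gauss_coeff q) 0 n M)
         + q ^ n * bsum q (gauss_coeff q) 0 n M); [ring|].
      rewrite <- E. ring.
    - intros r. unfold al1, gauss_coeff. rewrite zpow_m1_pred.
      transitivity (- zpow (- (1)) r * (zpow q r * zpow q (r - 1) * zpow q ((r - 1) * (r - 1)))); [ring|].
      rewrite <- !zpow_add by assumption.
      replace (r + (r - 1) + (r - 1) * (r - 1))%Z with (r * r)%Z by ring. ring. }
  split.
  - apply (Cmult_cancel_l (1 - q ^ (2 * n + 1))); [apply one_minus_pow_nz; (assumption || lia)|].
    rewrite bsum_down by assumption.
    rewrite (bsum_ext q (fun r => zpow q r * gauss_coeff q (r - 1)%Z) (fun r => - q * al1 (- r)%Z) 0), bsum_scal, <- bsum_reflect_0, A0.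
    + replace (2 * n + 1)%nat with (n + n + 1)%nat by lia. rewrite !Cpow_add_r, Cpow_1_r. ring.
    + intros r. unfold al1, gauss_coeff. rewrite zpow_m1_pred, zpow_m1_opp.
      transitivity (- zpow (- (1)) r * (zpow q r * zpow q ((r - 1) * (r - 1)))); [ring|].
      transitivity (- zpow (- (1)) r * (zpow q 1 * (zpow q (- r) * zpow q (- r * - r)))); [|rewrite zpow_1; ring].
      rewrite <- !zpow_add by assumption. do 2 f_equal. ring.
  - rewrite bsum_up by assumption.
    rewrite (bsum_ext q (fun r => zpow q (- r) * gauss_coeff q (r + 1)%Z) (fun r => - q * al1 r) 1), bsum_scal, A1; [ring|].
    intros r. unfold al1, gauss_coeff. rewrite zpow_m1_succ.
    transitivity (- zpow (- (1)) r * (zpow q (- r) * zpow q ((r + 1) * (r + 1)))); [ring|].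
    transitivity (- zpow (- (1)) r * (zpow q 1 * (zpow q r * zpow q (r * r)))); [|rewrite zpow_1; ring].
    rewrite <- !zpow_add by assumption. do 2 f_equal. ring.
Qed.

Lemma bailey_pair_gauss (q : C) e n M : (Cmod q < 1)%R -> q <> 0 -> (n + 2 <= M)%nat -> (e <= 1)%nat ->
  qpoch (q ^ 2) (q ^ 2) n * bsum q (gauss_coeff q) e n M = 1.
Proof.
  intros Hq H0 HM He.
  assert (E0 : qpoch (q ^ 2) (q ^ 2) n * bsum q (gauss_coeff q) 0 n M = 1).
  { clear He e. induction n as [|n IH].
    - rewrite bsum_0; [cbn; ring|]. unfold gauss_coeff. cbn. ring.
    - destruct (bailey_pair_gauss_step q n M) as [E1 E2]; [assumption..|lia|].
      rewrite <- IH by lia. rewrite <- E1, <- E2. cbn [qpoch].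
      rewrite <- Cpow_mult_r, <- Cpow_add_r.
      replace (2 + 2 * n)%nat with (2 * n + 2)%nat by lia. ring. }
  destruct e as [|[|e]]; [assumption| |lia].
  destruct (bailey_pair_gauss_step q n M) as [E1 E2]; [assumption..|]. now rewrite E1.
Qed.

Definition half_coeff (q : C) (r : Z) : C := zpow (- (1)) r * zpow q (2 * (r * r) + r).

(** Here reflection carries the shifted and twisted sequences back to multiples of [half_coeff], so
    the relations close up by themselves. They come with the factors 1 - q^(4n+2) and 1 - q^(4n+4),
    of which 1 - q^(2n+1) and 1 + q^(2n+2) respectively cancel. *)
Lemma bailey_pair_half_step (q : C) n M : (Cmod q < 1)%R -> q <> 0 -> (n + 2 <= M)%nat ->
  (1 + q * (q ^ 2) ^ n) * bsum (q ^ 2) (half_coeff q) 1 n M = bsum (q ^ 2) (half_coeff q) 0 n M /\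
  (1 - (q ^ 2) ^ S n) * bsum (q ^ 2) (half_coeff q) 0 (S n) M = bsum (q ^ 2) (half_coeff q) 1 n M.
Proof.
  intros Hq H0 HM.
  assert (Hq2 : (Cmod (q ^ 2) < 1)%R) by (apply Cmod_pow_lt_1; (assumption || lia)).
  assert (H02 : q ^ 2 <> 0) by now apply Cpow_nz.
  split.
  - apply (Cmult_cancel_l (1 - q ^ (2 * n + 1))); [apply one_minus_pow_nz; (assumption || lia)|].
    transitivity ((1 - (q ^ 2) ^ (2 * n + 1)) * bsum (q ^ 2) (half_coeff q) 1 n M).
    { rewrite <- !Cpow_mult_r.
      replace (2 * (2 * n + 1))%nat with (2 * n + 2 * n + 2)%nat by lia.
      rewrite !Cpow_add_r. simpl (q ^ 2). simpl (q ^ 1). ring. }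
    rewrite bsum_down by assumption.
    rewrite (bsum_ext (q ^ 2) (fun r => zpow (q ^ 2) r * half_coeff q (r - 1)%Z) (fun r => - q * half_coeff q (- r)%Z) 0), bsum_scal, <- bsum_reflect_0.
    + rewrite <- !Cpow_mult_r, Cpow_add_r, Cpow_1_r. ring.
    + intros r. unfold half_coeff. rewrite zpow_m1_pred, zpow_m1_opp, zpow_pow by assumption.
      transitivity (- zpow (- (1)) r * (zpow q (Z.of_nat 2 * r) * zpow q (2 * ((r - 1) * (r - 1)) + (r - 1)))); [ring|].
      transitivity (- zpow (- (1)) r * (zpow q 1 * zpow q (2 * (- r * - r) + - r))); [|rewrite zpow_1; ring].
      rewrite <- !(zpow_add q) by assumption. do 2 f_equal. ring.
  - apply (Cmult_cancel_l (1 - - (1) * (q ^ 2) ^ S n)).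
    { apply C_neq_1_of_Cmod. rewrite Cmod_mult, Cmod_m1, Rmult_1_l.
      apply Cmod_pow_lt_1; (assumption || lia). }
    transitivity ((1 - (q ^ 2) ^ (2 * n + 2)) * bsum (q ^ 2) (half_coeff q) 0 (S n) M).
    { replace (2 * n + 2)%nat with (S n + S n)%nat by lia. rewrite (Cpow_add_r (q ^ 2)). ring. }
    rewrite bsum_up by assumption.
    rewrite (bsum_ext (q ^ 2) (fun r => zpow (q ^ 2) (- r) * half_coeff q (r + 1)%Z) (fun r => q ^ 2 * half_coeff q (- r - 1)%Z) 1), bsum_scal, <- bsum_reflect_1 by
      (assumption || (intros r; unfold half_coeff; rewrite zpow_m1_pred, zpow_m1_succ, zpow_m1_opp, zpow_pow by assumption;
       transitivity (- zpow (- (1)) r * (zpow q (Z.of_nat 2 * - r) * zpow q (2 * ((r + 1) * (r + 1)) + (r + 1)))); [ring|];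
       transitivity (- zpow (- (1)) r * (zpow q (Z.of_nat 2) * zpow q (2 * ((- r - 1) * (- r - 1)) + (- r - 1)))); [|rewrite zpow_nat; ring];
       rewrite <- !(zpow_add q) by assumption; do 2 f_equal; ring)).
    rewrite (Cpow_S (q ^ 2)). ring.
Qed.

Lemma bailey_pair_half (q : C) n M : (Cmod q < 1)%R -> q <> 0 -> (n + 2 <= M)%nat ->
  qpoch (q ^ 2) (q ^ 2) n * qpoch (- q) (q ^ 2) n * bsum (q ^ 2) (half_coeff q) 0 n M = 1 /\
  qpoch (q ^ 2) (q ^ 2) n * qpoch (- q) (q ^ 2) (S n) * bsum (q ^ 2) (half_coeff q) 1 n M = 1.
Proof.
  intros Hq H0 HM.
  assert (E0 : qpoch (q ^ 2) (q ^ 2) n * qpoch (- q) (q ^ 2) n * bsum (q ^ 2) (half_coeff q) 0 n M = 1).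
  { induction n as [|n IH].
    - rewrite bsum_0; [cbn; ring|]. unfold half_coeff. cbn. ring.
    - destruct (bailey_pair_half_step q n M) as [E1 E2]; [assumption..|lia|].
      rewrite <- IH by lia. rewrite <- E1, <- E2. cbn [qpoch].
      rewrite (Cpow_S (q ^ 2) n). ring. }
  split; [assumption|].
  destruct (bailey_pair_half_step q n M) as [E1 E2]; [assumption..|].
  rewrite <- E0, <- E1. cbn [qpoch]. ring.
Qed.

(** * Convergence of complex sequences *)

(** Stated through a real null sequence, so that limits follow from real comparison; the passage to
    neighbourhood filters and to real and imaginary parts is made separately. *)
Definition clim (u : nat -> C) (l : C) : Prop := is_lim_seq (fun n => Cmod (u n - l)) 0.

Lemma is_lim_seq_0_le (u v : nat -> R) :
  (forall n, 0 <= u n <= v n)%R -> is_lim_seq v 0 -> is_lim_seq u 0.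
Proof.
  intros H Hv. apply (is_lim_seq_le_le (fun _ => 0%R) u v); [assumption|apply is_lim_seq_const|assumption].
Qed.

Lemma clim_le u l (v : nat -> R) :
  (forall n, Cmod (u n - l) <= v n)%R -> is_lim_seq v 0 -> clim u l.
Proof.
  intros H. apply is_lim_seq_0_le. intros n. split; [apply Cmod_ge_0|apply H].
Qed.

Lemma clim_ext u v l : (forall n, u n = v n) -> clim u l -> clim v l.
Proof.
  intros H. apply is_lim_seq_ext. intros n. now rewrite H.
Qed.

Lemma clim_const c : clim (fun _ => c) c.
Proof.
  apply (clim_le _ _ (fun _ => 0%R)); [|apply is_lim_seq_const].
  intros _. replace (c - c) with (RtoC 0) by ring. rewrite Cmod_0. lra.
Qed.

Lemma clim_comp u l (phi : nat -> nat) :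
  filterlim phi eventually eventually -> clim u l -> clim (fun n => u (phi n)) l.
Proof. intros Hp H. exact (filterlim_comp _ _ _ _ _ _ _ _ Hp H). Qed.

Lemma clim_plus u v a b : clim u a -> clim v b -> clim (fun n => u n + v n) (a + b).
Proof.
  intros Hu Hv.
  apply (clim_le _ _ (fun n => Cmod (u n - a) + Cmod (v n - b))%R).
  - intros n. replace (u n + v n - (a + b)) with ((u n - a) + (v n - b)) by ring.
    apply Cmod_triangle.
  - replace (Finite 0) with (Finite (0 + 0)) by (f_equal; ring).
    now apply is_lim_seq_plus'.
Qed.

Lemma clim_mult u v a b : clim u a -> clim v b -> clim (fun n => u n * v n) (a * b).
Proof.
  intros Hu Hv.
  apply (clim_le _ _ (fun n => Cmod (u n - a) * Cmod (v n - b)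
    + (Cmod (u n - a) * Cmod b + Cmod a * Cmod (v n - b)))%R).
  - intros n. replace (u n * v n - a * b)
      with ((u n - a) * (v n - b) + ((u n - a) * b + a * (v n - b))) by ring.
    rewrite <- !Cmod_mult.
    eapply Rle_trans; [apply Cmod_triangle|]. apply Rplus_le_compat_l, Cmod_triangle.
  - replace (Finite 0) with (Finite (0 * 0 + (0 * Cmod b + Cmod a * 0))) by (f_equal; ring).
    apply is_lim_seq_plus'; [now apply is_lim_seq_mult'|].
    apply is_lim_seq_plus'; apply is_lim_seq_mult'; (assumption || apply is_lim_seq_const).
Qed.

Lemma clim_scal c u a : clim u a -> clim (fun n => c * u n) (c * a).
Proof. intros H. apply clim_mult; [apply clim_const|assumption]. Qed.

Lemma clim_minus u v a b : clim u a -> clim v b -> clim (fun n => u n - v n) (a - b).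
Proof.
  intros Hu Hv. apply (clim_ext (fun n => u n + - (1) * v n)); [intros; ring|].
  replace (a - b) with (a + - (1) * b) by ring.
  apply clim_plus; [assumption|now apply clim_scal].
Qed.

Lemma clim_inv_bounded u (a : C) (c : R) : (0 < c)%R -> (forall n, c <= Cmod (u n))%R -> a <> 0 ->
  clim u a -> clim (fun n => / u n) (/ a).
Proof.
  intros Hc Hb Ha Hu.
  pose proof (proj1 (Cmod_gt_0 a) Ha) as Ha'.
  apply (clim_le _ _ (fun n => / (c * Cmod a) * Cmod (u n - a))%R).
  - intros n. pose proof (Hb n) as Hn.
    assert (Hun : u n <> 0) by (apply Cmod_gt_0; lra).
    replace (/ u n - / a) with (- (u n - a) / (u n * a)) by (field; now split).
    rewrite Cmod_div, Cmod_opp, Cmod_mult by now apply Cmult_neq_0.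
    unfold Rdiv. rewrite Rmult_comm. apply Rmult_le_compat_r; [apply Cmod_ge_0|].
    apply Rinv_le_contravar; nra.
  - replace (Finite 0) with (Finite (/ (c * Cmod a) * 0)) by (f_equal; ring).
    apply is_lim_seq_mult'; [apply is_lim_seq_const|assumption].
Qed.

Lemma clim_filterlim u (l : C) : clim u l -> filterlim u eventually (locally l).
Proof.
  intros H. apply filterlim_locally. intros eps.
  apply is_lim_seq_spec in H. destruct (H eps) as [N HN]. exists N. intros n Hn.
  apply C_NormedModule_mixin_compat1. specialize (HN n Hn).
  rewrite Rminus_0_r, Rabs_pos_eq in HN by apply Cmod_ge_0. exact HN.
Qed.

Lemma clim_Re_Im u l : clim u l ->
  is_lim_seq (fun n => Re (u n)) (Re l) /\ is_lim_seq (fun n => Im (u n)) (Im l).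
Proof.
  intros H. apply is_lim_seq_spec in H.
  split; apply is_lim_seq_spec; intros eps; destruct (H eps) as [N HN]; exists N;
    intros n Hn; specialize (HN n Hn);
    rewrite Rminus_0_r, Rabs_pos_eq in HN by apply Cmod_ge_0;
    (eapply Rle_lt_trans; [|exact HN]); (eapply Rle_trans; [|apply (Rmax_Cmod (u n - l))]).
  - apply (Rmax_l (Rabs (Re (u n) - Re l))).
  - apply (Rmax_r _ (Rabs (Im (u n) - Im l))).
Qed.

Lemma clim_of_Re_Im u (l : C) : is_lim_seq (fun n => Re (u n)) (Re l) ->
  is_lim_seq (fun n => Im (u n)) (Im l) -> clim u l.
Proof.
  intros H1 H2.
  assert (D : forall (v : nat -> R) (a : R), is_lim_seq v a -> is_lim_seq (fun n => Rabs (v n - a)) 0).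
  { intros v a Hv. apply is_lim_seq_spec. intros eps. apply is_lim_seq_spec in Hv.
    destruct (Hv eps) as [N HN]. exists N. intros n Hn.
    rewrite Rminus_0_r, Rabs_Rabsolu. now apply HN. }
  apply (clim_le _ _ (fun n => Rabs (Re (u n) - Re l) + Rabs (Im (u n) - Im l))%R).
  - intros n. set (x := (Re (u n) - Re l)%R). set (y := (Im (u n) - Im l)%R).
    replace (u n - l) with (RtoC x + Ci * RtoC y).
    + eapply Rle_trans; [apply Cmod_triangle|].
      rewrite Cmod_mult, Cmod_Ci, !Cmod_R. lra.
    + unfold x, y. destruct (u n), l. apply injective_projections; simpl; ring.
  - replace (Finite 0) with (Finite (0 + 0)) by (f_equal; ring).
    apply is_lim_seq_plus'; now apply D.
Qed.

Lemma clim_unique u a b : clim u a -> clim u b -> a = b.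
Proof.
  intros Ha Hb. apply clim_Re_Im in Ha, Hb. destruct Ha as [Ha1 Ha2], Hb as [Hb1 Hb2].
  apply is_lim_seq_unique in Ha1, Ha2, Hb1, Hb2.
  rewrite Ha1 in Hb1. rewrite Ha2 in Hb2. injection Hb1. injection Hb2.
  destruct a, b. simpl. now intros -> ->.
Qed.

(** * Dominated convergence for one-sided, triple and bilateral sums *)

Lemma rsum_sum_n N f : rsum N f = sum_n f N.
Proof.
  induction N as [|N IH]; [now rewrite sum_O|]. rewrite sum_Sn. simpl. now rewrite IH.
Qed.

Lemma rsum_le N f g : (forall n, f n <= g n)%R -> (rsum N f <= rsum N g)%R.
Proof. intros H. induction N; simpl; [apply H|]. now apply Rplus_le_compat. Qed.

Lemma rsum_nonneg N f : (forall n, 0 <= f n)%R -> (0 <= rsum N f)%R.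
Proof. intros H. induction N; simpl; [apply H|]. specialize (H (S N)). lra. Qed.

Lemma rsum_scal N c f : rsum N (fun n => c * f n)%R = (c * rsum N f)%R.
Proof. induction N as [|N IH]; simpl; [reflexivity|rewrite IH; ring]. Qed.

Lemma rsum_mono f M N : (forall n, 0 <= f n)%R -> (M <= N)%nat -> (rsum M f <= rsum N f)%R.
Proof.
  intros H HMN. induction HMN as [|N HMN IH]; [lra|]. simpl. specialize (H (S N)). lra.
Qed.

Lemma rsum_le_Series N g : (forall n, 0 <= g n)%R -> ex_series g -> (rsum N g <= Series g)%R.
Proof.
  intros H Hg. rewrite rsum_sum_n.
  apply (is_lim_seq_incr_compare (sum_n g)).
  - apply Series_correct in Hg. exact Hg.
  - intros n. rewrite sum_Sn. specialize (H (S n)). unfold plus. simpl. lra.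
Qed.

Lemma Cmod_csum N f : (Cmod (csum N f) <= rsum N (fun n => Cmod (f n)))%R.
Proof.
  induction N as [|N IH]; simpl; [lra|].
  eapply Rle_trans; [apply Cmod_triangle|]. lra.
Qed.

(** The tail of [g] beyond some [R0] bounds all longer partial sums at once, so the upper limit
    [phi N] may be any sequence. *)
Lemma tannery_zero (u : nat -> nat -> R) (g : nat -> R) (phi : nat -> nat) :
  (forall N n, 0 <= u N n <= g n)%R -> (forall n, is_lim_seq (fun N => u N n) 0) ->
  ex_series g -> is_lim_seq (fun N => rsum (phi N) (u N)) 0.
Proof.
  intros Hu Hl Hg.
  assert (Hg0 : forall n, (0 <= g n)%R) by (intros n; specialize (Hu 0%nat n); lra).
  assert (Hfin : forall R0, is_lim_seq (fun N => rsum R0 (u N)) 0).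
  { intros R0. induction R0 as [|R0 IH]; simpl; [apply Hl|].
    replace (Finite 0) with (Finite (0 + 0)) by (f_equal; ring).
    now apply is_lim_seq_plus'. }
  apply is_lim_seq_spec. intros eps.
  assert (He : (0 < eps / 2)%R) by (pose proof (cond_pos eps); lra).
  assert (HS : is_lim_seq (sum_n g) (Series g)) by exact (Series_correct g Hg).
  apply is_lim_seq_spec in HS. destruct (HS (mkposreal _ He)) as [R0 HR0]. simpl in HR0.
  specialize (HR0 R0 (Nat.le_refl _)). rewrite <- rsum_sum_n in HR0. apply Rabs_def2 in HR0.
  specialize (Hfin R0). apply is_lim_seq_spec in Hfin.
  destruct (Hfin (mkposreal _ He)) as [N0 HN0]. simpl in HN0.
  exists N0. intros N HN. specialize (HN0 N HN).
  assert (Hun : forall n, (0 <= u N n)%R) by (intros n; apply Hu).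
  rewrite Rminus_0_r, Rabs_pos_eq in HN0 |- * by now apply rsum_nonneg.
  assert (T : forall m, (rsum m (u N) <= rsum R0 (u N) + eps / 2)%R).
  { intros m. destruct (Nat.le_gt_cases m R0) as [Hm|Hm].
    - pose proof (rsum_mono (u N) m R0 Hun Hm). lra.
    - assert (D : (rsum m (u N) - rsum R0 (u N) <= rsum m g - rsum R0 g)%R).
      { induction Hm as [|m Hm IH]; simpl.
        - pose proof (Hu N (S R0)). lra.
        - pose proof (Hu N (S m)). lra. }
      pose proof (rsum_le_Series m g Hg0 Hg). lra. }
  specialize (T (phi N)). lra.
Qed.

(** With a = a w + a (1 - w), the first part converges by hypothesis and the second tends to 0 by
    [tannery_zero], nested once per index. The dominating term is a product, so that summing out one
    index leaves a bound of the same form in the others. *)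
Lemma tannery_box3 (a : nat -> nat -> nat -> C) (w : nat -> nat -> nat -> nat -> C)
  (g : nat -> R) (K W : R) (l : C) :
  (forall n, 0 <= g n)%R -> ex_series g -> (0 <= K)%R ->
  (forall i j k, Cmod (a i j k) <= K * (g i * (g j * g k)))%R ->
  (forall N i j k, Cmod (w N i j k) <= W)%R ->
  (forall i j k, clim (fun N => w N i j k) 1) ->
  clim (fun N => box3 (fun i j k => a i j k * w N i j k) N) l ->
  triple_sum a l.
Proof.
  intros Hg0 Hg HK Ha Hw Hw1 Hl.
  set (G := Series g).
  assert (HG : forall N, (rsum N g <= G)%R) by (intros; now apply rsum_le_Series).
  assert (HG0 : (0 <= G)%R) by (eapply Rle_trans; [apply (rsum_nonneg 0 g Hg0)|apply HG]).
  assert (HW : (0 <= W)%R) by (eapply Rle_trans; [apply Cmod_ge_0|apply (Hw 0 0 0 0)%nat]).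
  (* Each index that is summed out replaces a factor of the bound by the total [G]. *)
  assert (B : forall (b : nat -> nat -> nat -> R) (L : R) N, (0 <= L)%R ->
     (forall i j k, 0 <= b i j k <= L * (g i * (g j * g k)))%R ->
     (forall i j, 0 <= rsum N (b i j) <= L * G * (g i * g j))%R /\
     (forall i, 0 <= rsum N (fun j => rsum N (b i j)) <= L * G * G * g i)%R /\
     (0 <= rsum N (fun i => rsum N (fun j => rsum N (b i j))) <= L * G * G * G)%R).
  { intros b L N HL Hb.
    assert (B1 : forall i j, (0 <= rsum N (b i j) <= L * G * (g i * g j))%R).
    { intros i j. split; [apply rsum_nonneg; intros; apply Hb|].
      eapply Rle_trans; [apply (rsum_le N _ (fun k => L * (g i * g j) * g k)%R)|].
      - intros k. specialize (Hb i j k). lra.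
      - rewrite rsum_scal. pose proof (Rmult_le_pos _ _ (Hg0 i) (Hg0 j)).
        pose proof (Rmult_le_pos _ _ HL H). pose proof (HG N). nra. }
    assert (HLG : (0 <= L * G)%R) by now apply Rmult_le_pos.
    assert (B2 : forall i, (0 <= rsum N (fun j => rsum N (b i j)) <= L * G * G * g i)%R).
    { intros i. split; [apply rsum_nonneg; intros; apply B1|].
      eapply Rle_trans; [apply (rsum_le N _ (fun j => L * G * g i * g j)%R)|].
      - intros j. specialize (B1 i j). lra.
      - rewrite rsum_scal. pose proof (Rmult_le_pos _ _ HLG (Hg0 i)). pose proof (HG N). nra. }
    assert (HLGG : (0 <= L * G * G)%R) by now apply Rmult_le_pos.
    repeat split; try apply B1; try apply B2.
    - apply rsum_nonneg. intros; apply B2.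
    - eapply Rle_trans; [apply (rsum_le N _ (fun i => L * G * G * g i)%R); apply B2|].
      rewrite rsum_scal. pose proof (HG N). nra. }
  split.
  - exists (K * G * G * G)%R. intros N. apply (B (fun i j k => Cmod (a i j k)) K N HK).
    intros i j k. split; [apply Cmod_ge_0|apply Ha].
  - apply clim_filterlim.
    set (b := fun N i j k => Cmod (a i j k * (1 - w N i j k))).
    set (L := (K * (1 + W))%R).
    assert (HL : (0 <= L)%R) by (apply Rmult_le_pos; lra).
    assert (Hb : forall N i j k, (0 <= b N i j k <= L * (g i * (g j * g k)))%R).
    { intros N i j k. split; [apply Cmod_ge_0|]. unfold b, L. rewrite Cmod_mult.
      assert (Hm : (Cmod (1 - w N i j k) <= 1 + W)%R).
      { eapply Rle_trans; [apply Cmod_triangle|]. rewrite Cmod_opp, Cmod_1. specialize (Hw N i j k). lra. }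
      replace (K * (1 + W) * (g i * (g j * g k)))%R with (K * (g i * (g j * g k)) * (1 + W))%R by ring.
      apply Rmult_le_compat; try apply Cmod_ge_0; [apply Ha|exact Hm]. }
    assert (Hex : forall c, ex_series (fun n => c * g n)%R) by (intros c; exact (ex_series_scal_l c g Hg)).
    assert (Z : is_lim_seq (fun N => rsum N (fun i => rsum N (fun j => rsum N (b N i j)))) 0).
    { apply (tannery_zero (fun N i => rsum N (fun j => rsum N (b N i j)))
        (fun i => L * G * G * g i)%R (fun N => N)); [| |apply Hex].
      - intros N i. apply (B (b N) L N HL (Hb N)).
      - intros i. apply (tannery_zero (fun N j => rsum N (b N i j))
          (fun j => L * G * g i * g j)%R (fun N => N)); [| |apply Hex].
        + intros N j. destruct (B (b N) L N HL (Hb N)) as [B1 _]. specialize (B1 i j). lra.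
        + intros j. apply (tannery_zero (fun N => b N i j)
            (fun k => L * (g i * g j) * g k)%R (fun N => N)); [| |apply Hex].
          * intros N k. specialize (Hb N i j k). lra.
          * intros k. unfold b.
            assert (E : clim (fun N => a i j k * (1 - w N i j k)) (a i j k * (1 - 1))).
            { apply clim_scal, clim_minus; [apply clim_const|apply Hw1]. }
            refine (is_lim_seq_ext _ _ _ _ E). intros N. f_equal. ring. }
    assert (E : clim (fun N => box3 (fun i j k => a i j k * w N i j k) N
       + box3 (fun i j k => a i j k * (1 - w N i j k)) N) (l + 0)).
    { apply clim_plus; [assumption|]. refine (clim_le _ _ _ _ Z). intros N.
      replace (box3 (fun i j k => a i j k * (1 - w N i j k)) N - 0)
        with (box3 (fun i j k => a i j k * (1 - w N i j k)) N) by ring.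
      unfold box3. eapply Rle_trans; [apply Cmod_csum|]. apply rsum_le. intros i.
      eapply Rle_trans; [apply Cmod_csum|]. apply rsum_le. intros j. apply Cmod_csum. }
    rewrite Cplus_0_r in E. refine (clim_ext _ _ _ _ E). intros N. unfold box3.
    rewrite <- csum_plus. apply csum_ext. intros i _.
    rewrite <- csum_plus. apply csum_ext. intros j _.
    rewrite <- csum_plus. apply csum_ext. intros k _. ring.
Qed.

Lemma tannery_zsum (c : Z -> C) (w : nat -> Z -> C) (g : nat -> R) (W : R) (phi : nat -> nat) :
  ex_series g -> (forall r, Cmod (c r) <= g (Z.abs_nat r))%R ->
  (forall N r, Cmod (w N r) <= W)%R -> (forall r, clim (fun N => w N r) 0) ->
  clim (fun N => zsum (phi N) (fun r => c r * w N r)) 0.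
Proof.
  intros Hg Hc Hw Hw0.
  assert (HW : (0 <= W)%R) by (eapply Rle_trans; [apply Cmod_ge_0|apply (Hw 0%nat 0%Z)]).
  assert (Hg0 : forall n, (0 <= g n)%R).
  { intros n. eapply Rle_trans; [apply Cmod_ge_0|]. specialize (Hc (Z.of_nat n)).
    rewrite Zabs2Nat.id in Hc. exact Hc. }
  refine (clim_le _ _ (fun N => rsum (phi N) (fun n => Cmod (zfold (fun r => c r * w N r) n))) _ _).
  - intros N. replace (zsum (phi N) (fun r => c r * w N r) - 0)
      with (zsum (phi N) (fun r => c r * w N r)) by ring. apply Cmod_csum.
  - assert (T : forall N r, (Cmod (c r * w N r) <= W * g (Z.abs_nat r))%R).
    { intros N r. rewrite Cmod_mult, Rmult_comm.
      apply Rmult_le_compat; try apply Cmod_ge_0; [apply Hw|apply Hc]. }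
    apply (tannery_zero (fun N n => Cmod (zfold (fun r => c r * w N r) n)) (fun n => 2 * W * g n)%R).
    + intros N n. split; [apply Cmod_ge_0|]. unfold zfold.
      destruct n as [|n].
      * eapply Rle_trans; [apply T|]. simpl Z.abs_nat.
        pose proof (Rmult_le_pos _ _ HW (Hg0 0%nat)). lra.
      * eapply Rle_trans; [apply Cmod_triangle|].
        pose proof (T N (Z.of_nat (S n))) as T1. pose proof (T N (- Z.of_nat (S n))%Z) as T2.
        replace (Z.abs_nat (- Z.of_nat (S n))) with (S n) in T2 by lia.
        rewrite Zabs2Nat.id in T1. lra.
    + assert (L : forall r, clim (fun N => c r * w N r) 0).
      { intros r. replace (RtoC 0) with (c r * 0) by ring. now apply clim_scal. }
      intros n. assert (L' : clim (fun N => zfold (fun r => c r * w N r) n) 0).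
      { destruct n as [|n]; unfold zfold; [apply L|].
        replace (RtoC 0) with (0 + 0) by ring. apply clim_plus; apply L. }
      refine (is_lim_seq_ext _ _ _ _ L'). intros N. f_equal. ring.
    + exact (ex_series_scal_l (2 * W)%R g Hg).
Qed.

(** * Bounds and limits of q-Pochhammer symbols *)

Lemma Cmod_1_minus_le x : (1 - Cmod x <= Cmod (1 - x) <= 1 + Cmod x)%R.
Proof.
  split.
  - assert (H : (Cmod 1 <= Cmod (1 - x) + Cmod x)%R).
    { eapply Rle_trans; [|apply Cmod_triangle]. right. f_equal. ring. }
    rewrite Cmod_1 in H. lra.
  - unfold Cminus. eapply Rle_trans; [apply Cmod_triangle|]. rewrite Cmod_opp, Cmod_1. lra.
Qed.

Lemma exp_le x y : (x <= y -> exp x <= exp y)%R.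
Proof. intros [H| ->]; [left; now apply exp_increasing|lra]. Qed.

(** Each factor is at most 1 + |a| |q|^k <= exp(|a| |q|^k), and the quotient in the exponent is the
    geometric sum of the |q|^k. *)
Lemma qpoch_Cmod_exp a q n : (Cmod q < 1)%R ->
  (Cmod (qpoch a q n) <= exp (Cmod a * ((1 - Cmod q ^ n) / (1 - Cmod q))))%R.
Proof.
  intros Hq. pose proof (Cmod_ge_0 a) as Ha. pose proof (Cmod_ge_0 q) as Hq0.
  induction n as [|n IH]; simpl.
  - rewrite Cmod_1. replace (Cmod a * ((1 - 1) / (1 - Cmod q)))%R with 0%R by (field; lra).
    rewrite exp_0. lra.
  - rewrite Cmod_mult.
    replace (Cmod a * ((1 - Cmod q * Cmod q ^ n) / (1 - Cmod q)))%R
      with (Cmod a * ((1 - Cmod q ^ n) / (1 - Cmod q)) + Cmod a * Cmod q ^ n)%R by (field; lra).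
    rewrite exp_plus. apply Rmult_le_compat; try apply Cmod_ge_0; [exact IH|].
    eapply Rle_trans; [apply Cmod_1_minus_le|]. rewrite Cmod_mult, Cmod_pow.
    apply exp_ineq1_le.
Qed.

Lemma qpoch_bounded a q : (Cmod q < 1)%R -> exists K, forall n, (Cmod (qpoch a q n) <= K)%R.
Proof.
  intros Hq. exists (exp (Cmod a / (1 - Cmod q))). intros n.
  eapply Rle_trans; [now apply qpoch_Cmod_exp|]. apply exp_le.
  unfold Rdiv. apply Rmult_le_compat_l; [apply Cmod_ge_0|].
  rewrite <- (Rmult_1_l (/ (1 - Cmod q))) at 2.
  apply Rmult_le_compat_r; [left; apply Rinv_0_lt_compat; lra|].
  pose proof (pow_le (Cmod q) n (Cmod_ge_0 q)). lra.
Qed.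

(** For x = |a| |q|^k one has 1 / (1 - x) = 1 + x / (1 - x) <= 1 + x / (1 - |a|) <= exp(B |q|^k)
    with B = |a| / (1 - |a|); the geometric sum then bounds the reciprocal of the product. *)
Lemma qpoch_bounded_below a q : (Cmod a < 1)%R -> (Cmod q < 1)%R ->
  exists c, (0 < c)%R /\ forall n, (c <= Cmod (qpoch a q n))%R.
Proof.
  intros Ha Hq. pose proof (Cmod_ge_0 a) as Ha0. pose proof (Cmod_ge_0 q) as Hq0.
  set (B := (Cmod a / (1 - Cmod a))%R).
  assert (HB : (0 <= B)%R) by (apply Rdiv_le_0_compat; lra).
  assert (H : forall n, (1 <= Cmod (qpoch a q n) * exp (B * ((1 - Cmod q ^ n) / (1 - Cmod q))))%R).
  { induction n as [|n IH]; simpl.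
    - rewrite Cmod_1. replace (B * ((1 - 1) / (1 - Cmod q)))%R with 0%R by (field; lra).
      rewrite exp_0. lra.
    - set (x := (Cmod a * Cmod q ^ n)%R).
      assert (Hp : (0 <= Cmod q ^ n <= 1)%R).
      { split; [now apply pow_le|]. rewrite <- (pow1 n). apply pow_incr. lra. }
      assert (Hx : (0 <= x <= Cmod a)%R) by (unfold x; split; [apply Rmult_le_pos|]; nra).
      assert (F : (1 <= Cmod (1 - a * q ^ n) * exp (B * Cmod q ^ n))%R).
      { apply Rle_trans with ((1 - x) * (1 + B * Cmod q ^ n))%R.
        - replace (B * Cmod q ^ n)%R with (x / (1 - Cmod a))%R by (unfold B, x; field; lra).
          apply Rle_trans with ((1 - x) * (1 + x / (1 - x)))%R; [right; field; lra|].
          apply Rmult_le_compat_l; [lra|]. apply Rplus_le_compat_l.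
          unfold Rdiv. apply Rmult_le_compat_l; [lra|]. apply Rinv_le_contravar; lra.
        - apply Rmult_le_compat; [lra| |
            |apply exp_ineq1_le].
          + pose proof (Rmult_le_pos _ _ HB (proj1 Hp)). lra.
          + eapply Rle_trans; [|apply Cmod_1_minus_le]. rewrite Cmod_mult, Cmod_pow. fold x. lra. }
      rewrite Cmod_mult.
      replace (B * ((1 - Cmod q * Cmod q ^ n) / (1 - Cmod q)))%R
        with (B * ((1 - Cmod q ^ n) / (1 - Cmod q)) + B * Cmod q ^ n)%R by (field; lra).
      rewrite exp_plus.
      replace (Cmod (qpoch a q n) * Cmod (1 - a * q ^ n)
        * (exp (B * ((1 - Cmod q ^ n) / (1 - Cmod q))) * exp (B * Cmod q ^ n)))%R
        with ((Cmod (qpoch a q n) * exp (B * ((1 - Cmod q ^ n) / (1 - Cmod q))))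
        * (Cmod (1 - a * q ^ n) * exp (B * Cmod q ^ n)))%R by ring.
      nra. }
  exists (/ exp (B / (1 - Cmod q)))%R. split; [apply Rinv_0_lt_compat, exp_pos|].
  intros n. specialize (H n).
  assert (E : (exp (B * ((1 - Cmod q ^ n) / (1 - Cmod q))) <= exp (B / (1 - Cmod q)))%R).
  { apply exp_le. unfold Rdiv. apply Rmult_le_compat_l; [assumption|].
    rewrite <- (Rmult_1_l (/ (1 - Cmod q))) at 2.
    apply Rmult_le_compat_r; [left; apply Rinv_0_lt_compat; lra|].
    pose proof (pow_le (Cmod q) n (Cmod_ge_0 q)). lra. }
  pose proof (exp_pos (B / (1 - Cmod q))) as E0.
  apply (Rmult_le_reg_r (exp (B / (1 - Cmod q)))); [assumption|].
  rewrite Rinv_l by lra. pose proof (Cmod_ge_0 (qpoch a q n)). nra.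
Qed.

Lemma ex_lim_of_geometric_increments (u : nat -> R) (B r : R) :
  (0 <= r < 1)%R -> (forall n, Rabs (u (S n) - u n) <= B * r ^ n)%R ->
  exists l : R, is_lim_seq u l.
Proof.
  intros Hr Hu.
  assert (S1 : ex_series (fun n => u (S n) - u n)%R).
  { apply (ex_series_le (V := R_CompleteNormedModule) _ (fun n => B * r ^ n)%R); [exact Hu|].
    apply (ex_series_scal_l B (fun n => r ^ n)%R). apply ex_series_geom.
    rewrite Rabs_pos_eq; apply Hr. }
  destruct S1 as [l Hl]. exists (l + u 0%nat)%R.
  apply is_lim_seq_incr_1.
  assert (E : forall n, (sum_n (fun n => u (S n) - u n) n + u 0%nat = u (S n))%R).
  { induction n as [|n IH]; [rewrite sum_O; ring|]. rewrite sum_Sn. unfold plus. simpl.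
    simpl in IH. lra. }
  apply (is_lim_seq_ext (fun n => sum_n (fun n => u (S n) - u n)%R n + u 0%nat)%R); [exact E|].
  apply is_lim_seq_plus'; [exact Hl|apply is_lim_seq_const].
Qed.

(** [Lim_seq] assigns a value to every sequence, so it is this lemma that makes [qpoch_inf] the
    infinite product: the increments are bounded by a geometric sequence, hence the limits exist. *)
Lemma qpoch_clim a q : (Cmod q < 1)%R -> clim (qpoch a q) (qpoch_inf a q).
Proof.
  intros Hq. destruct (qpoch_bounded a q Hq) as [K HK].
  assert (D : forall n, (Cmod (qpoch a q (S n) - qpoch a q n) <= K * Cmod a * Cmod q ^ n)%R).
  { intros n. replace (qpoch a q (S n) - qpoch a q n) with (- (qpoch a q n * (a * q ^ n)))
      by (simpl; ring).
    rewrite Cmod_opp, !Cmod_mult, Cmod_pow, <- Rmult_assoc.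
    apply Rmult_le_compat_r; [apply pow_le, Cmod_ge_0|].
    apply Rmult_le_compat_r; [apply Cmod_ge_0|apply HK]. }
  assert (Hr : (0 <= Cmod q < 1)%R) by (split; [apply Cmod_ge_0|assumption]).
  destruct (ex_lim_of_geometric_increments (fun n => Re (qpoch a q n)) (K * Cmod a)%R (Cmod q) Hr) as [x Hx].
  { intros n. eapply Rle_trans; [|apply D]. eapply Rle_trans; [|apply Rmax_Cmod].
    apply (Rmax_l (Rabs (Re (qpoch a q (S n)) - Re (qpoch a q n)))). }
  destruct (ex_lim_of_geometric_increments (fun n => Im (qpoch a q n)) (K * Cmod a)%R (Cmod q) Hr) as [y Hy].
  { intros n. eapply Rle_trans; [|apply D]. eapply Rle_trans; [|apply Rmax_Cmod].
    apply (Rmax_r _ (Rabs (Im (qpoch a q (S n)) - Im (qpoch a q n)))). }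
  apply clim_of_Re_Im; unfold qpoch_inf; simpl.
  - now rewrite (is_lim_seq_unique _ _ Hx).
  - now rewrite (is_lim_seq_unique _ _ Hy).
Qed.

Lemma qpoch_inf_eq a q l : clim (qpoch a q) l -> (Cmod q < 1)%R -> qpoch_inf a q = l.
Proof. intros Hl Hq. exact (clim_unique _ _ _ (qpoch_clim a q Hq) Hl). Qed.

Lemma qpoch_inf_nz a q : (Cmod a < 1)%R -> (Cmod q < 1)%R -> qpoch_inf a q <> 0.
Proof.
  intros Ha Hq E. destruct (qpoch_bounded_below a q Ha Hq) as [c [Hc Hn]].
  pose proof (qpoch_clim a q Hq) as H. rewrite E in H.
  assert (L : (c <= 0)%R).
  { apply (is_lim_seq_le (fun _ => c) (fun n => Cmod (qpoch a q n - 0)) c 0);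
      [|apply is_lim_seq_const|exact H].
    intros n. unfold Cminus. rewrite Copp_0, Cplus_0_r. apply Hn. }
  lra.
Qed.

Lemma iqpoch_bounded (q : C) : (Cmod q < 1)%R ->
  exists K, (0 <= K)%R /\ forall z, (Cmod (iqpoch q z) <= K)%R.
Proof.
  intros Hq. destruct (qpoch_bounded_below q q Hq Hq) as [c [Hc Hn]].
  exists (/ c)%R. assert (H : (0 < / c)%R) by now apply Rinv_0_lt_compat.
  split; [lra|]. intros z. unfold iqpoch. destruct (z <? 0)%Z; [rewrite Cmod_0; lra|].
  rewrite Cmod_inv by now apply qpoch_nz. now apply Rinv_le_contravar.
Qed.

Lemma iqpoch_clim (q : C) (phi : nat -> Z) (d : Z) : (Cmod q < 1)%R ->
  (forall n, phi n = (Z.of_nat n + d)%Z) -> clim (fun n => iqpoch q (phi n)) (/ qpoch_inf q q).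
Proof.
  intros Hq Hphi. destruct (qpoch_bounded_below q q Hq Hq) as [c [Hc Hn]].
  assert (H : clim (fun n => / qpoch q q (Z.to_nat (Z.of_nat n + d))) (/ qpoch_inf q q)).
  { apply clim_inv_bounded with (c := c); [assumption|now intros|now apply qpoch_inf_nz|].
    apply (clim_comp (qpoch q q)); [|now apply qpoch_clim].
    intros P [N HN]. exists (N + Z.abs_nat d)%nat. intros n Hle. apply HN. lia. }
  unfold clim in *. apply (is_lim_seq_ext_loc _ _ _) with (2 := H).
  exists (Z.abs_nat d). intros n Hle. rewrite Hphi. unfold iqpoch.
  rewrite (proj2 (Z.ltb_ge _ _)) by lia. reflexivity.
Qed.

(** * Domination, weights, and the sum over k *)

Lemma triple_sum_ext a b l l' : (forall i j k, a i j k = b i j k) -> l = l' ->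
  triple_sum a l -> triple_sum b l'.
Proof.
  intros Hab <- Ha. replace b with a; [assumption|].
  do 3 (apply functional_extensionality; intro). apply Hab.
Qed.

Lemma ex_series_pow_pred r : (0 <= r < 1)%R -> ex_series (fun n => r ^ (n - 1))%R.
Proof.
  intros Hr. apply ex_series_incr_1.
  apply (ex_series_ext (fun n => r ^ n)%R); [intros n; f_equal; lia|].
  apply ex_series_geom. rewrite Rabs_pos_eq; apply Hr.
Qed.

Lemma pow_le_pow_of_ge r m n : (0 <= r <= 1)%R -> (m <= n)%nat -> (r ^ n <= r ^ m)%R.
Proof.
  intros Hr Hmn. replace n with (m + (n - m))%nat by lia. rewrite pow_add.
  rewrite <- (Rmult_1_r (r ^ m)) at 2. apply Rmult_le_compat_l; [now apply pow_le|].
  rewrite <- (pow1 (n - m)). now apply pow_incr.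
Qed.

(** A linear lower bound for the quadratic exponents is all that domination by powers of |q|
    requires. Truncated subtraction makes it hold at k = 0 too. *)
Lemma triangle_ge_pred k : (k - 1 <= k * (k - 1) / 2)%nat.
Proof. apply Nat.div_le_lower_bound; destruct k as [|[|k]]; nia. Qed.

(* Tends to 1, and turns the truncated sums over [k] and [j] into finite q-binomial sums. *)
Definition weight (q t : C) (N i k m : nat) : C :=
  (qpoch q q N * iqpoch q (Z.of_nat N - Z.of_nat k))
  * (qpoch (- t) q N / qpoch (- t) q (N + i))
  * (qpoch q q N * iqpoch q (Z.of_nat N - Z.of_nat m)).

Lemma weight_bounded (q t : C) : (Cmod q < 1)%R -> (Cmod t < 1)%R ->
  exists W, forall N i k m, (Cmod (weight q t N i k m) <= W)%R.
Proof.
  intros Hq Ht.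
  destruct (qpoch_bounded q q Hq) as [K1 HK1]. destruct (iqpoch_bounded q Hq) as [K2 [_ HK2]].
  destruct (qpoch_bounded (- t) q Hq) as [K3 HK3].
  destruct (qpoch_bounded_below (- t) q) as [c [Hc Hb]]; [now rewrite Cmod_opp|assumption|].
  exists (K1 * K2 * (K3 * / c) * (K1 * K2))%R. intros N i k m.
  unfold weight, Cdiv. rewrite !Cmod_mult, Cmod_inv by (apply qpoch_nz; [now rewrite Cmod_opp|assumption]).
  assert (E : (/ Cmod (qpoch (- t) q (N + i)) <= / c)%R) by now apply Rinv_le_contravar.
  assert (E0 : (0 <= / Cmod (qpoch (- t) q (N + i)))%R).
  { left. apply Rinv_0_lt_compat. specialize (Hb (N + i)%nat). lra. }
  repeat (apply Rmult_le_compat; repeat apply Rmult_le_pos; try apply Cmod_ge_0; auto).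
Qed.

Lemma weight_clim (q t : C) i k m : (Cmod q < 1)%R -> (Cmod t < 1)%R ->
  clim (fun N => weight q t N i k m) 1.
Proof.
  intros Hq Ht. assert (Ht' : (Cmod (- t) < 1)%R) by now rewrite Cmod_opp.
  pose proof (qpoch_inf_nz q q Hq Hq) as H1. pose proof (qpoch_inf_nz (- t) q Ht' Hq) as H2.
  replace (RtoC 1) with ((qpoch_inf q q * / qpoch_inf q q)
    * (qpoch_inf (- t) q * / qpoch_inf (- t) q) * (qpoch_inf q q * / qpoch_inf q q))
    by (field; now split).
  destruct (qpoch_bounded_below (- t) q Ht' Hq) as [c [Hc Hb]].
  unfold weight. repeat apply clim_mult; try now apply qpoch_clim.
  - now apply iqpoch_clim with (d := (- Z.of_nat k)%Z).
  - apply clim_inv_bounded with (c := c); [assumption|intros; apply Hb|assumption|].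
    apply (clim_comp (qpoch (- t) q) _ (fun N => N + i)%nat); [|now apply qpoch_clim].
    intros P [N0 HN0]. exists N0. intros n Hn. apply HN0. lia.
  - now apply iqpoch_clim with (d := (- Z.of_nat m)%Z).
Qed.

(** This is [finite_euler] at x = t q^i. The product (-t q^i;q)_N that it produces cancels against
    (-t;q)_(N+i) = (-t;q)_i (-t q^i;q)_N, which is the purpose of the middle factor of [weight]. *)
Lemma weight_sum (q t : C) N i m : (Cmod q < 1)%R -> (Cmod t < 1)%R ->
  csum N (fun k => t ^ k * q ^ (k * (k - 1) / 2) * q ^ (i * k) / qpoch q q k * weight q t N i k m)
  = qpoch (- t) q N / qpoch (- t) q i * (qpoch q q N * iqpoch q (Z.of_nat N - Z.of_nat m)).
Proof.
  intros Hq Ht. assert (Ht' : (Cmod (- t) < 1)%R) by now rewrite Cmod_opp.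
  assert (Hnz : forall n, qpoch (- t) q n <> 0) by (intros; now apply qpoch_nz).
  transitivity (qpoch q q N * (qpoch (- t) q N / qpoch (- t) q (N + i))
      * (qpoch q q N * iqpoch q (Z.of_nat N - Z.of_nat m))
      * csum N (fun k => (t * q ^ i) ^ k * q ^ (k * (k - 1) / 2)
         * iqpoch q (Z.of_nat k) * iqpoch q (Z.of_nat N - Z.of_nat k))).
  - rewrite <- csum_scal. apply csum_ext. intros k _. unfold weight.
    rewrite Cpow_mult_l, <- Cpow_mult_r, iqpoch_nat. unfold Cdiv. ring.
  - rewrite finite_euler, iqpoch_nat by assumption.
    rewrite (Nat.add_comm N i), qpoch_add.
    replace (- (t * q ^ i)) with (- t * q ^ i) by ring.
    assert (H : qpoch (- t * q ^ i) q N <> 0).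
    { intros E. apply (Hnz (i + N)%nat). rewrite qpoch_add, E. ring. }
    field. repeat split; auto. now apply qpoch_nz.
Qed.

(** * Evaluation of the two families of triple sums *)

Lemma Cmod_div3_le (x d1 d2 d3 : C) (K y : R) : (0 <= K)%R ->
  d1 <> 0 -> d2 <> 0 -> d3 <> 0 ->
  (Cmod (/ d1) <= K)%R -> (Cmod (/ d2) <= K)%R -> (Cmod (/ d3) <= K)%R ->
  (Cmod x <= y)%R -> (Cmod (x / (d1 * d2 * d3)) <= K * K * K * y)%R.
Proof.
  intros HK H1 H2 H3 K1 K2 K3 Hx.
  replace (x / (d1 * d2 * d3)) with (/ d1 * / d2 * / d3 * x) by (field; now repeat split).
  rewrite !Cmod_mult. pose proof (Cmod_ge_0 x).
  repeat apply Rmult_le_compat; repeat apply Rmult_le_pos; try apply Cmod_ge_0; assumption.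
Qed.

Lemma iqpoch_bound_nat (q : C) : (Cmod q < 1)%R ->
  exists K, (0 <= K)%R /\ forall n, (Cmod (/ qpoch q q n) <= K)%R.
Proof.
  intros Hq. destruct (iqpoch_bounded q Hq) as [K [HK H]]. exists K. split; [assumption|].
  intros n. rewrite <- iqpoch_nat. apply H.
Qed.

(** The common form of the first three identities, with x = 1, q^(1/2) and q. The first factor of
    the value comes from the sum over k, the second from the sum over m = 2i + j. *)
Lemma triple_sum_product (q x : C) : (Cmod q < 1)%R -> (Cmod x <= 1)%R ->
  triple_sum
    (fun i j k => x ^ (2 * i + j) * q ^ ((2 * i + j) * (2 * i + j - 1) / 2) * q ^ (j * (j - 1) / 2)
       * (q ^ k * q ^ (k * (k - 1) / 2) * q ^ (i * k))
       / (qpoch q q i * qpoch q q j * qpoch q q k))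
    (qpoch_inf (- q) q * qpoch_inf (- x) q).
Proof.
  intros Hq Hx.
  pose proof (Cmod_ge_0 q) as Hq0.
  assert (Hnz : forall n, qpoch q q n <> 0) by (intros; now apply qpoch_nz).
  assert (Hq2 : (Cmod (q ^ 2) < 1)%R) by (apply Cmod_pow_lt_1; [assumption|lia]).
  destruct (iqpoch_bound_nat q Hq) as [K [HK HKb]].
  destruct (weight_bounded q q Hq Hq) as [W HW].
  apply (tannery_box3 _ (fun N i j k => weight q q N i k (2 * i + j))
    (fun n => Cmod q ^ (n - 1))%R (K * K * K) W).
  - intros n. now apply pow_le.
  - apply ex_series_pow_pred. lra.
  - now repeat apply Rmult_le_pos.
  - intros i j k. apply Cmod_div3_le; auto.
    rewrite !Cmod_mult, !Cmod_pow, <- !pow_add.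
    rewrite <- (Rmult_1_l (_ ^ (i - 1 + _))).
    rewrite !Rmult_assoc, <- !pow_add. apply Rmult_le_compat.
    + apply pow_le, Cmod_ge_0.
    + now apply pow_le.
    + rewrite <- (pow1 (2 * i + j)). apply pow_incr. split; [apply Cmod_ge_0|assumption].
    + apply pow_le_pow_of_ge; [lra|].
      pose proof (triangle_ge_pred (2 * i + j)). pose proof (triangle_ge_pred j).
      pose proof (triangle_ge_pred k). lia.
  - intros. apply HW.
  - intros. now apply weight_clim.
  - apply (clim_ext (fun N => qpoch (- q) q N * qpoch (- x) q N)).
    2: { apply clim_mult; now apply qpoch_clim. }
    intros N. symmetry. unfold box3.
    set (F := fun i m => x ^ m * q ^ (m * (m - 1) / 2) * iqpoch q (Z.of_nat N - Z.of_nat m)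
       * (q ^ ((m - 2 * i) * (m - 2 * i - 1) / 2)
       * iqpoch q (Z.of_nat m - 2 * Z.of_nat i) * iqpoch (q ^ 2) (Z.of_nat i))).
    transitivity (qpoch (- q) q N * qpoch q q N * csum N (fun i => csum N (F i))).
    + rewrite <- csum_scal. apply csum_ext. intros i _.
      (* Replacing j by m = 2i + j keeps the range, since [F i m] vanishes for m < 2i and for m >
         N. *)
      rewrite <- (csum_shift (2 * i) N (F i)).
      2: { intros n Hn. unfold F. rewrite (iqpoch_neg q (Z.of_nat n - _)) by lia. ring. }
      2: { intros n Hn. unfold F. rewrite (iqpoch_neg q (Z.of_nat N - _)) by lia. ring. }
      rewrite <- csum_scal. apply csum_ext. intros j _.
      transitivity (x ^ (2 * i + j) * q ^ ((2 * i + j) * (2 * i + j - 1) / 2) * q ^ (j * (j - 1) / 2)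
        / (qpoch q q i * qpoch q q j)
        * csum N (fun k => q ^ k * q ^ (k * (k - 1) / 2) * q ^ (i * k) / qpoch q q k
            * weight q q N i k (2 * i + j))).
      * rewrite <- csum_scal. apply csum_ext. intros k _. field. auto.
      * rewrite weight_sum by assumption. unfold F.
        replace (2 * i + j - 2 * i)%nat with j by lia.
        replace (Z.of_nat (2 * i + j) - 2 * Z.of_nat i)%Z with (Z.of_nat j) by lia.
        rewrite (iqpoch_nat q j), (iqpoch_nat (q ^ 2) i), <- qpoch_opp_mult.
        field. repeat split; auto. apply qpoch_nz; [now rewrite Cmod_opp|assumption].
    + rewrite csum_swap.
      rewrite (csum_ext N _ (fun m => x ^ m * q ^ (m * (m - 1) / 2)
                     * iqpoch q (Z.of_nat m) * iqpoch q (Z.of_nat N - Z.of_nat m))).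
      * rewrite finite_euler, iqpoch_nat by assumption. field. auto.
      * intros m Hm. unfold F. rewrite csum_scal, two_step_sum by assumption. ring.
Qed.

(** For fixed r, [bailey_step] sums over i and then over n = i + j, each time contributing q^(r^2 +
    e r). The last factor of the summand, supplied by the weight, is the kernel of the second
    step. *)
Lemma bailey_chain (q : C) (al : Z -> C) (e N M : nat) : (Cmod q < 1)%R -> (e <= 1)%nat ->
  csum N (fun i => csum N (fun j =>
    q ^ (i * i + e * i) * bsum q al e i M
      * (q ^ ((i + j) * (i + j) + e * (i + j)) * iqpoch q (Z.of_nat j)
         * iqpoch q (Z.of_nat N - Z.of_nat (i + j)))))
  = bsum q (fun r => zpow q (r * r + Z.of_nat e * r) * zpow q (r * r + Z.of_nat e * r) * al r) e N M.
Proof.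
  intros Hq He.
  set (F := fun i n => q ^ (i * i + e * i) * bsum q al e i M
      * (q ^ (n * n + e * n) * iqpoch q (Z.of_nat n - Z.of_nat i)
         * iqpoch q (Z.of_nat N - Z.of_nat n))).
  transitivity (csum N (fun i => csum N (F i))).
  { apply csum_ext. intros i _. rewrite <- (csum_shift i N (F i)).
    - apply csum_ext. intros j _. unfold F.
      replace (Z.of_nat (i + j) - Z.of_nat i)%Z with (Z.of_nat j) by lia. reflexivity.
    - intros n Hn. unfold F. rewrite (iqpoch_neg q (Z.of_nat n - _)) by lia. ring.
    - intros n Hn. unfold F. rewrite (iqpoch_neg q (Z.of_nat N - _)) by lia. ring. }
  rewrite csum_swap.
  transitivity (csum N (fun n => zsum M (fun r => al r * zpow q (r * r + Z.of_nat e * r)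
     * (q ^ (n * n + e * n) * iqpoch q (Z.of_nat N - Z.of_nat n)
     * (iqpoch q (Z.of_nat n - r) * iqpoch q (Z.of_nat n + r + Z.of_nat e)))))).
  - apply csum_ext. intros n Hn. unfold F, bsum.
    transitivity (csum N (fun i => zsum M (fun r =>
      q ^ (n * n + e * n) * iqpoch q (Z.of_nat N - Z.of_nat n) * al r
      * (q ^ (i * i + e * i) * iqpoch q (Z.of_nat n - Z.of_nat i)
        * (iqpoch q (Z.of_nat i - r) * iqpoch q (Z.of_nat i + r + Z.of_nat e)))))).
    + apply csum_ext. intros i _.
      match goal with |- ?a * ?b * ?c = _ => transitivity (a * c * b); [ring|] end.
      rewrite <- zsum_scal. apply zsum_ext. intros r. ring.
    + rewrite zsum_csum_swap. apply zsum_ext. intros r.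
      rewrite csum_scal, bailey_step by assumption. ring.
  - rewrite zsum_csum_swap. apply zsum_ext. intros r.
    rewrite csum_scal, bailey_step by (assumption || lia). ring.
Qed.

Lemma theta_coeff_bound (u v : C) r : (Cmod u < 1)%R -> (Cmod v < 1)%R ->
  (Cmod (theta_coeff u v r) <= Rmax (Cmod u) (Cmod v) ^ (Z.abs_nat r - 1))%R.
Proof.
  intros Hu Hv. set (R0 := Rmax (Cmod u) (Cmod v)).
  assert (HR : (0 <= R0 < 1)%R).
  { split; [eapply Rle_trans; [apply (Cmod_ge_0 u)|apply Rmax_l]|now apply Rmax_lub_lt]. }
  (* The two exponents a, b >= 0 satisfy a - b = r, which already gives a + b >= |r|. *)
  assert (T : exists a b, (r * (r + 1) / 2 = Z.of_nat a)%Z /\ (r * (r - 1) / 2 = Z.of_nat b)%Z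
     /\ (Z.abs_nat r - 1 <= a + b)%nat).
  { assert (E : (r * (r + 1) / 2 = r * (r - 1) / 2 + r)%Z).
    { rewrite <- Z.div_add by lia. f_equal. ring. }
    assert (P1 : (0 <= r * (r - 1) / 2)%Z) by (apply Z.div_pos; nia).
    assert (P2 : (0 <= r * (r + 1) / 2)%Z) by (apply Z.div_pos; nia).
    exists (Z.to_nat (r * (r + 1) / 2)), (Z.to_nat (r * (r - 1) / 2)).
    rewrite !Z2Nat.id by assumption. repeat split; lia. }
  destruct T as [a [b [Ea [Eb Hab]]]]. unfold theta_coeff. rewrite Ea, Eb, !zpow_nat, !Cmod_mult, !Cmod_pow.
  assert (S : Cmod (zpow (- (1)) r) = 1%R).
  { unfold zpow. destruct (0 <=? r)%Z; rewrite ?Cmod_inv, Cmod_pow, Cmod_m1, pow1;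
      rewrite ?Rinv_1; try reflexivity. apply Cpow_nz, m1_nz. }
  rewrite S, Rmult_1_l.
  apply Rle_trans with (R0 ^ (a + b))%R; [|apply pow_le_pow_of_ge; [lra|assumption]].
  rewrite pow_add. apply Rmult_le_compat; try (apply pow_le, Cmod_ge_0).
  - apply pow_incr. split; [apply Cmod_ge_0|apply Rmax_l].
  - apply pow_incr. split; [apply Cmod_ge_0|apply Rmax_r].
Qed.

(* Up to weights tending to constants, this sum and the one in [finite_jacobi] are both the theta series [sum_r theta_coeff u v r]. *)
Lemma bsum_theta_clim (q u v : C) (e : nat) : (Cmod q < 1)%R -> (Cmod u < 1)%R -> (Cmod v < 1)%R ->
  u <> 0 -> v <> 0 ->
  clim (fun N => qpoch q q N * bsum q (theta_coeff u v) e N (N + 2))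
    (qpoch_inf u (u * v) * qpoch_inf v (u * v) * qpoch_inf (u * v) (u * v) / qpoch_inf q q).
Proof.
  intros Hq Hu Hv Hu0 Hv0. set (P := u * v).
  assert (HP : (Cmod P < 1)%R) by (apply Cmod_mult_lt_1; lra).
  pose proof (qpoch_inf_nz q q Hq Hq) as Hqi. pose proof (qpoch_inf_nz P P HP HP) as HPi.
  destruct (qpoch_bounded q q Hq) as [K1 HK1]. destruct (iqpoch_bounded q Hq) as [K2 [HK2p HK2]].
  destruct (qpoch_bounded P P HP) as [K3 HK3]. destruct (iqpoch_bounded P HP) as [K4 [HK4p HK4]].
  (* The difference of the two kernels, each scaled to tend to 1 for fixed r; hence [w] tends to 0
     although the bases q and uv may differ. *)
  set (w := fun N r => qpoch_inf q q * (qpoch q q N * (iqpoch q (Z.of_nat N - r) * iqpoch q (Z.of_nat N + r + Z.of_nat e)))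
    - qpoch_inf P P * (qpoch P P (2 * N) * (iqpoch P (Z.of_nat N - r) * iqpoch P (Z.of_nat N + r)))).
  assert (HR : (0 <= Rmax (Cmod u) (Cmod v) < 1)%R).
  { split; [eapply Rle_trans; [apply (Cmod_ge_0 u)|apply Rmax_l]|now apply Rmax_lub_lt]. }
  assert (Z : clim (fun N => zsum (N + 2) (fun r => theta_coeff u v r * w N r)) 0).
  { apply (tannery_zsum _ _ (fun n => Rmax (Cmod u) (Cmod v) ^ (n - 1))%R
      (Cmod (qpoch_inf q q) * (K1 * (K2 * K2)) + Cmod (qpoch_inf P P) * (K3 * (K4 * K4)))%R).
    - now apply ex_series_pow_pred.
    - intros r. now apply theta_coeff_bound.
    - intros N r. unfold w, Cminus. eapply Rle_trans; [apply Cmod_triangle|].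
      rewrite Cmod_opp, !Cmod_mult.
      apply Rplus_le_compat; (apply Rmult_le_compat_l; [apply Cmod_ge_0|]);
        (apply Rmult_le_compat; repeat apply Rmult_le_pos; try apply Cmod_ge_0; auto);
        apply Rmult_le_compat; try apply Cmod_ge_0; auto.
    - intros r. unfold w.
      replace (RtoC 0) with (qpoch_inf q q * (qpoch_inf q q * (/ qpoch_inf q q * / qpoch_inf q q))
         - qpoch_inf P P * (qpoch_inf P P * (/ qpoch_inf P P * / qpoch_inf P P)))
        by (field; now split).
      apply clim_minus; apply clim_scal; apply clim_mult.
      + now apply qpoch_clim.
      + apply clim_mult; [apply iqpoch_clim with (d := (- r)%Z)|apply iqpoch_clim with (d := (r + Z.of_nat e)%Z)];
          (assumption || (intros; ring)).
      + apply (clim_comp (qpoch P P)); [|now apply qpoch_clim].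
        intros Q [N0 HN0]. exists N0. intros n Hn. apply HN0. lia.
      + apply clim_mult; [apply iqpoch_clim with (d := (- r)%Z)|apply iqpoch_clim with (d := r)];
          (assumption || (intros; ring)). }
  replace (qpoch_inf u P * qpoch_inf v P * qpoch_inf P P / qpoch_inf q q)
    with (/ qpoch_inf q q * (0 + qpoch_inf P P * (qpoch_inf u P * qpoch_inf v P))) by (field; assumption).
  apply (clim_ext (fun N => / qpoch_inf q q * (zsum (N + 2) (fun r => theta_coeff u v r * w N r)
     + qpoch_inf P P * (qpoch u P N * qpoch v P N)))).
  - intros N. unfold P at 3 4. rewrite <- (finite_jacobi u v N (N + 2)) by (assumption || lia).
    fold P. unfold bsum.
    apply (Cmult_cancel_l (qpoch_inf q q)); [assumption|].
    rewrite Cmult_assoc, Cinv_r, Cmult_1_l by assumption.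
    rewrite !Cmult_assoc, <- !zsum_scal, <- zsum_plus. apply zsum_ext. intros r. unfold w. ring.
  - apply clim_scal, clim_plus; [assumption|].
    apply clim_scal, clim_mult; now apply qpoch_clim.
Qed.

(** In the value, (-t;q)_oo comes from the sum over k, the three factors in u and v from the theta
    series, and 1 / (q;q)_oo from the limit of the kernel. The constant [kappa] normalizes the pair:
    it is 1 except in the last identity, where (-q;q^2)_(n+1) = (1 + q) (-q^3;q^2)_n makes it 1 +
    q. *)
Lemma triple_sum_bailey (q t kappa u v : C) (e : nat) (al : Z -> C) :
  (Cmod q < 1)%R -> (Cmod t < 1)%R -> (Cmod u < 1)%R -> (Cmod v < 1)%R ->
  u <> 0 -> v <> 0 -> (e <= 1)%nat ->
  (forall n M, (n + 2 <= M)%nat ->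
     qpoch q q n * qpoch (- t) q n * (kappa * bsum q al e n M) = 1) ->
  (forall r, zpow q (r * r + Z.of_nat e * r) * zpow q (r * r + Z.of_nat e * r) * al r
     = theta_coeff u v r) ->
  triple_sum
    (fun i j k => q ^ (i * i + e * i) * q ^ ((i + j) * (i + j) + e * (i + j))
       * (t ^ k * q ^ (k * (k - 1) / 2) * q ^ (i * k))
       / (qpoch q q i * qpoch q q j * qpoch q q k))
    (kappa * qpoch_inf (- t) q
      * (qpoch_inf u (u * v) * qpoch_inf v (u * v) * qpoch_inf (u * v) (u * v)) / qpoch_inf q q).
Proof.
  intros Hq Ht Hu Hv Hu0 Hv0 He Hpair Hth.
  pose proof (Cmod_ge_0 q) as Hq0.
  assert (Ht' : (Cmod (- t) < 1)%R) by now rewrite Cmod_opp.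
  assert (Hnz : forall n, qpoch q q n <> 0) by (intros; now apply qpoch_nz).
  assert (Htnz : forall n, qpoch (- t) q n <> 0) by (intros; now apply qpoch_nz).
  destruct (iqpoch_bound_nat q Hq) as [K [HK HKb]].
  destruct (weight_bounded q t Hq Ht) as [W HW].
  apply (tannery_box3 _ (fun N i j k => weight q t N i k (i + j))
    (fun n => Cmod q ^ (n - 1))%R (K * K * K) W).
  - intros n. now apply pow_le.
  - apply ex_series_pow_pred. lra.
  - now repeat apply Rmult_le_pos.
  - intros i j k. apply Cmod_div3_le; auto.
    replace (q ^ (i * i + e * i) * q ^ ((i + j) * (i + j) + e * (i + j))
       * (t ^ k * q ^ (k * (k - 1) / 2) * q ^ (i * k)))
      with (t ^ k * q ^ ((i * i + e * i) + ((i + j) * (i + j) + e * (i + j)) + k * (k - 1) / 2 + i * k))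
      by (rewrite !Cpow_add_r; ring).
    rewrite Cmod_mult, !Cmod_pow, <- !pow_add.
    rewrite <- (Rmult_1_l (_ ^ (i - 1 + _))). apply Rmult_le_compat.
    + apply pow_le, Cmod_ge_0.
    + now apply pow_le.
    + rewrite <- (pow1 k). apply pow_incr. split; [apply Cmod_ge_0|lra].
    + apply pow_le_pow_of_ge; [lra|]. pose proof (triangle_ge_pred k). nia.
  - intros. apply HW.
  - intros. now apply weight_clim.
  - pose proof (qpoch_inf_nz q q Hq Hq) as Hqi.
    replace (kappa * qpoch_inf (- t) q
      * (qpoch_inf u (u * v) * qpoch_inf v (u * v) * qpoch_inf (u * v) (u * v)) / qpoch_inf q q)
      with (kappa * (qpoch_inf (- t) q * (qpoch_inf u (u * v) * qpoch_inf v (u * v)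
        * qpoch_inf (u * v) (u * v) / qpoch_inf q q))) by (field; assumption).
    (* The window N + 2 meets the condition n + 2 <= M of the Bailey pair for every n <= N. *)
    apply (clim_ext (fun N => kappa * (qpoch (- t) q N
      * (qpoch q q N * bsum q (theta_coeff u v) e N (N + 2))))).
    2: { apply clim_scal, clim_mult; [now apply qpoch_clim|now apply bsum_theta_clim]. }
    intros N. symmetry.
    rewrite <- (bsum_ext q _ _ e N (N + 2) Hth), <- bailey_chain by assumption.
    rewrite !Cmult_assoc, <- csum_scal. apply csum_ext. intros i Hi.
    rewrite <- csum_scal. apply csum_ext. intros j _.
    transitivity (q ^ (i * i + e * i) * q ^ ((i + j) * (i + j) + e * (i + j)) / (qpoch q q i * qpoch q q j)
        * csum N (fun k => t ^ k * q ^ (k * (k - 1) / 2) * q ^ (i * k) / qpoch q q k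
            * weight q t N i k (i + j))).
    + rewrite <- csum_scal. apply csum_ext. intros k _. field. auto.
    + rewrite weight_sum by assumption. rewrite (iqpoch_nat q j).
      assert (E : kappa * bsum q al e i (N + 2) = / (qpoch q q i * qpoch (- t) q i)).
      { apply (Cmult_cancel_l (qpoch q q i * qpoch (- t) q i)); [now apply Cmult_neq_0|].
        rewrite Hpair by lia. field. auto. }
      transitivity ((kappa * bsum q al e i (N + 2)) * qpoch (- t) q N * qpoch q q N
        * q ^ (i * i + e * i) * q ^ ((i + j) * (i + j) + e * (i + j)) * / qpoch q q j
        * iqpoch q (Z.of_nat N - Z.of_nat (i + j))); [|ring].
      rewrite E. field. auto.
Qed.

(** * Infinite products, and sums reduced to their constant term *)

Lemma clim_qpoch_mult (a q : C) m : (Cmod q < 1)%R -> (0 < m)%nat ->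
  clim (fun n => qpoch a q (m * n)) (qpoch_inf a q).
Proof.
  intros Hq Hm. apply (clim_comp (qpoch a q)); [|now apply qpoch_clim].
  intros P [N HN]. exists N. intros n Hn. apply HN. nia.
Qed.

Lemma qpoch_inf_split2 (a q : C) : (Cmod q < 1)%R ->
  qpoch_inf a q = qpoch_inf a (q ^ 2) * qpoch_inf (a * q) (q ^ 2).
Proof.
  intros Hq. assert (Hq2 : (Cmod (q ^ 2) < 1)%R) by (apply Cmod_pow_lt_1; [assumption|lia]).
  apply (clim_unique (fun n => qpoch a q (2 * n))); [apply clim_qpoch_mult; [assumption|lia]|].
  apply (clim_ext (fun n => qpoch a (q ^ 2) n * qpoch (a * q) (q ^ 2) n)).
  2: { apply clim_mult; now apply qpoch_clim. }
  induction n as [|n IH]; [cbn; ring|].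
  replace (2 * S n)%nat with (S (S (2 * n))) by lia. cbn [qpoch].
  rewrite <- IH, (Cpow_S q (2 * n)), <- (Cpow_mult_r q 2 n). ring.
Qed.

Lemma qpoch_inf_split3 (a q : C) : (Cmod q < 1)%R ->
  qpoch_inf a q = qpoch_inf a (q ^ 3) * qpoch_inf (a * q) (q ^ 3) * qpoch_inf (a * q ^ 2) (q ^ 3).
Proof.
  intros Hq. assert (Hq3 : (Cmod (q ^ 3) < 1)%R) by (apply Cmod_pow_lt_1; [assumption|lia]).
  apply (clim_unique (fun n => qpoch a q (3 * n))); [apply clim_qpoch_mult; [assumption|lia]|].
  apply (clim_ext (fun n => qpoch a (q ^ 3) n * qpoch (a * q) (q ^ 3) n * qpoch (a * q ^ 2) (q ^ 3) n)).
  2: { repeat apply clim_mult; now apply qpoch_clim. }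
  induction n as [|n IH]; [cbn; ring|].
  replace (3 * S n)%nat with (S (S (S (3 * n)))) by lia. cbn [qpoch].
  rewrite <- IH, (Cpow_S q (S (3 * n))), (Cpow_S q (3 * n)), <- (Cpow_mult_r q 3 n). ring.
Qed.

Lemma qpoch_inf_opp_mult (a q : C) : (Cmod q < 1)%R ->
  qpoch_inf a q * qpoch_inf (- a) q = qpoch_inf (a ^ 2) (q ^ 2).
Proof.
  intros Hq. assert (Hq2 : (Cmod (q ^ 2) < 1)%R) by (apply Cmod_pow_lt_1; [assumption|lia]).
  symmetry. apply (clim_unique (qpoch (a ^ 2) (q ^ 2))); [now apply qpoch_clim|].
  apply (clim_ext (fun n => qpoch a q n * qpoch (- a) q n)).
  - intros n. apply qpoch_opp_mult.
  - apply clim_mult; now apply qpoch_clim.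
Qed.

Lemma qpoch_inf_shift (a q : C) : (Cmod q < 1)%R ->
  qpoch_inf a q = (1 - a) * qpoch_inf (a * q) q.
Proof.
  intros Hq. apply (clim_unique (fun n => qpoch a q (S n))).
  - apply (clim_comp (qpoch a q)); [|now apply qpoch_clim].
    intros P [N HN]. exists N. intros n Hn. apply HN. lia.
  - apply (clim_ext (fun n => (1 - a) * qpoch (a * q) q n)).
    + intros n. change (S n) with (1 + n)%nat. rewrite qpoch_add.
      simpl qpoch. simpl Cpow. rewrite !Cmult_1_r. ring.
    + apply clim_scal. now apply qpoch_clim.
Qed.

Lemma qpoch_inf_0 (q : C) : (Cmod q < 1)%R -> qpoch_inf 0 q = 1.
Proof.
  intros Hq. apply qpoch_inf_eq; [|assumption].
  apply (clim_ext (fun _ => RtoC 1)); [|apply clim_const].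
  induction n as [|n IH]; cbn [qpoch]; [reflexivity|]. rewrite <- IH. ring.
Qed.

Lemma triple_sum_origin (a : nat -> nat -> nat -> C) :
  (forall i j k, (0 < i + j + k)%nat -> a i j k = 0) -> triple_sum a (a 0%nat 0%nat 0%nat).
Proof.
  intros H.
  assert (E : forall (b : nat -> nat -> nat -> C), (forall i j k, (0 < i + j + k)%nat -> b i j k = 0) ->
    forall N, box3 b N = b 0%nat 0%nat 0%nat).
  { intros b Hb N. unfold box3. rewrite csum_only_first.
    - rewrite csum_only_first.
      + apply csum_only_first. intros n Hn. apply Hb. lia.
      + intros n Hn. apply csum_zero. intros; apply Hb; lia.
    - intros n Hn. apply csum_zero. intros; apply csum_zero; intros; apply Hb; lia. }
  (* The sequence 0^n is 1 at n = 0 and 0 elsewhere, so the bound is sharp. *)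
  apply (tannery_box3 a (fun _ _ _ _ => 1) (fun n => 0 ^ n)%R (Cmod (a 0 0 0)%nat) 1).
  - intros n. apply pow_le. lra.
  - apply ex_series_geom. rewrite Rabs_R0. lra.
  - apply Cmod_ge_0.
  - intros i j k. destruct (Nat.eq_dec (i + j + k) 0) as [E0|E0].
    + assert (i = 0 /\ j = 0 /\ k = 0)%nat as [-> [-> ->]] by lia. simpl. lra.
    + rewrite H, Cmod_0 by lia. repeat apply Rmult_le_pos; try apply pow_le; try lra. apply Cmod_ge_0.
  - intros. rewrite Cmod_1. lra.
  - intros. apply clim_const.
  - apply (clim_ext (fun _ => a 0%nat 0%nat 0%nat)); [|apply clim_const].
    intros N. rewrite E.
    + ring.
    + intros i j k Hijk. rewrite H by assumption. ring.
Qed.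

(** * Exponents and the seven identities *)

Lemma triangle_double n : (2 * (n * (n - 1) / 2) + n = n * n)%nat.
Proof. induction n as [|n IH]; [reflexivity|]. rewrite triangle_succ. nia. Qed.

Lemma triangle_up k : (k * (k + 1) / 2 = k * (k - 1) / 2 + k)%nat.
Proof. rewrite <- triangle_succ. f_equal. lia. Qed.

Lemma Cpow_0_l n : (0 < n)%nat -> 0 ^ n = 0 :> C.
Proof. destruct n; [lia|]. intros _. rewrite Cpow_S. ring. Qed.

(** The exponent equals ((a + b) r^2 + (a - b) r) / 2, from which a and b are read off in the last
    four identities. *)
Lemma theta_exponent (q : C) (a b : nat) r : q <> 0 ->
  theta_coeff (q ^ a) (q ^ b) r
  = zpow (- (1)) r * zpow q (Z.of_nat a * (r * (r + 1) / 2) + Z.of_nat b * (r * (r - 1) / 2)).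
Proof.
  intros Hq. unfold theta_coeff. rewrite !zpow_pow, zpow_add by assumption. ring.
Qed.

Lemma triangle_double_Z r :
  (2 * (r * (r + 1) / 2) = r * r + r /\ 2 * (r * (r - 1) / 2) = r * r - r)%Z.
Proof.
  assert (E : (r * (r + 1) / 2 = r * (r - 1) / 2 + r)%Z).
  { rewrite <- Z.div_add by lia. f_equal. ring. }
  assert (H : exists m, (r * (r - 1) = m * 2)%Z).
  { destruct (Z.Even_or_Odd r) as [[m Hm]|[m Hm]].
    - exists (m * (r - 1))%Z. rewrite Hm at 1. ring.
    - exists (r * m)%Z. rewrite Hm at 2. ring. }
  destruct H as [m Hm]. rewrite E, Hm, Z.div_mul by lia. split; lia.
Qed.

Lemma identities_1_2_3 (q s : C) : (Cmod q < 1)%R -> s * s = q ->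
  triple_sum
    (fun i j k => q ^ (2*i*i + j*j + (k*(k+1))/2 + 2*i*j + i*k - i - j)
       / (qpoch q q i * qpoch q q j * qpoch q q k))
    (2 * qpoch_inf (q^2) (q^2) ^ 2 / qpoch_inf q q ^ 2)
  /\
  triple_sum
    (fun i j k => s ^ (4*i*i + 2*j*j + k*k + 4*i*j + 2*i*k - j + k)
       / (qpoch q q i * qpoch q q j * qpoch q q k))
    (1 / qpoch_inf s q)
  /\
  triple_sum
    (fun i j k => q ^ (2*i*i + j*j + (k*(k+1))/2 + 2*i*j + i*k + i)
       / (qpoch q q i * qpoch q q j * qpoch q q k))
    (qpoch_inf (q^2) (q^2) ^ 2 / qpoch_inf q q ^ 2).
Proof.
  intros Hq Hs.
  assert (Hs1 : (Cmod s < 1)%R).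
  { pose proof (Cmod_ge_0 s). apply Rnot_le_lt. intros H1.
    rewrite <- Hs, Cmod_mult in Hq. nra. }
  assert (Hq2 : (Cmod (q ^ 2) < 1)%R) by (apply Cmod_pow_lt_1; (assumption || lia)).
  pose proof (qpoch_inf_nz q q Hq Hq) as Z1.
  pose proof (qpoch_inf_nz s q Hs1 Hq) as Z2.
  pose proof (qpoch_inf_opp_mult q q Hq) as E1.
  assert (E2 : qpoch_inf (- q) q = qpoch_inf (q ^ 2) (q ^ 2) / qpoch_inf q q).
  { rewrite <- E1. field. assumption. }
  split; [|split].
  - refine (triple_sum_ext _ _ _ _ _ _ (triple_sum_product q 1 Hq _)).
    + intros i j k. f_equal. rewrite Cpow_1_l, Cmult_1_l, <- !Cpow_add_r. f_equal.
      rewrite triangle_up.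
      pose proof (triangle_double (2 * i + j)). pose proof (triangle_double j).
      (* These inequalities ensure that the natural-number subtractions in the exponent are not
         truncated. *)
      assert (i <= i * i /\ j <= j * j)%nat by nia. nia.
    (* For x = 1 the leading factor of (-1;q)_oo is 2, the constant of the first identity. *)
    + rewrite (qpoch_inf_shift (- (1))) by assumption.
      replace (- (1) * q) with (- q) by ring. rewrite E2. field. assumption.
    + rewrite Cmod_1. lra.
  - refine (triple_sum_ext _ _ _ _ _ _ (triple_sum_product q s Hq _)).
    + intros i j k. f_equal. rewrite <- Hs.
      assert (T : forall n, (s * s) ^ n = s ^ (2 * n)).
      { intros n. rewrite Cpow_mult_r. f_equal. simpl. ring. }
      rewrite !T, <- !Cpow_add_r. f_equal.
      pose proof (triangle_double (2 * i + j)). pose proof (triangle_double j).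
      pose proof (triangle_double k).
      assert (j <= j * j)%nat by nia. nia.
    (* (s;q)_oo (-s;q)_oo = (q;q^2)_oo, and by Euler (-q;q)_oo is the reciprocal of the same
       product. *)
    + pose proof (qpoch_inf_opp_mult s q Hq) as E3.
      replace (s ^ 2) with q in E3 by (rewrite <- Hs; ring).
      pose proof (qpoch_inf_split2 q q Hq) as E4.
      replace (q * q) with (q ^ 2) in E4 by ring.
      assert (Z3 : qpoch_inf q (q ^ 2) <> 0) by now apply qpoch_inf_nz.
      assert (Z4 : qpoch_inf (q ^ 2) (q ^ 2) <> 0) by now apply qpoch_inf_nz.
      rewrite E2, E4. replace (qpoch_inf (- s) q) with (qpoch_inf q (q ^ 2) / qpoch_inf s q)
        by (rewrite <- E3; field; assumption).
      field. repeat split; assumption.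
    + lra.
  - refine (triple_sum_ext _ _ _ _ _ _ (triple_sum_product q q Hq _)).
    + intros i j k. f_equal. rewrite <- !Cpow_add_r. f_equal. rewrite triangle_up.
      pose proof (triangle_double (2 * i + j)). pose proof (triangle_double j). nia.
    + rewrite E2. field. assumption.
    + lra.
Qed.

Lemma identity_4 (q : C) : (Cmod q < 1)%R -> q <> 0 ->
  triple_sum
    (fun i j k => q ^ (2*i*i + j*j + (k*(k+1))/2 + 2*i*j + i*k)
       / (qpoch q q i * qpoch q q j * qpoch q q k))
    (qpoch_inf (q^2) (q^2) * qpoch_inf (q^3) (q^3) ^ 2
       / (qpoch_inf q q ^ 2 * qpoch_inf (q^6) (q^6))).
Proof.
  intros Hq H0.
  assert (Hp : forall n, (0 < n)%nat -> (Cmod (q ^ n) < 1)%R) by (intros; now apply Cmod_pow_lt_1).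
  assert (Hnz : forall m n, (0 < m)%nat -> (0 < n)%nat -> qpoch_inf (q ^ m) (q ^ n) <> 0)
    by (intros; apply qpoch_inf_nz; auto).
  (* Two Bailey steps raise the exponent r^2 to 3 r^2, hence u = v = q^3. *)
  refine (triple_sum_ext _ _ _ _ _ _ (triple_sum_bailey q q 1 (q ^ 3) (q ^ 3) 0 (gauss_coeff q)
    Hq Hq _ _ _ _ _ _ _)); try (apply Hp; lia); try now apply Cpow_nz.
  - intros i j k. f_equal. rewrite <- !Cpow_add_r. f_equal. rewrite triangle_up. nia.
  - replace (q ^ 3 * q ^ 3) with (q ^ 6) by ring.
    pose proof (qpoch_inf_opp_mult q q Hq) as E1.
    pose proof (qpoch_inf_split2 (q ^ 3) (q ^ 3) (Hp 3%nat ltac:(lia))) as E2.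
    replace (q ^ 3 * q ^ 3) with (q ^ 6) in E2 by ring.
    replace ((q ^ 3) ^ 2) with (q ^ 6) in E2 by ring.
    rewrite E2, <- E1. pose proof (Hnz 1 1)%nat as Z1. rewrite Cpow_1_r in Z1.
    field. auto with arith.
  - lia.
  - intros n M HM. rewrite qpoch_opp_mult, Cmult_1_l. now apply bailey_pair_gauss; [| |lia|lia].
  - intros r. rewrite theta_exponent by assumption. unfold gauss_coeff.
    transitivity (zpow (- (1)) r * (zpow q (r * r + Z.of_nat 0 * r) * zpow q (r * r + Z.of_nat 0 * r) * zpow q (r * r))); [ring|].
    rewrite <- !zpow_add by assumption. do 2 f_equal.
    pose proof (triangle_double_Z r). lia.
Qed.

Lemma identity_5 (q : C) : (Cmod q < 1)%R -> q <> 0 ->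
  triple_sum
    (fun i j k => q ^ (2*i*i + j*j + (k*(k+1))/2 + 2*i*j + i*k + 2*i + j)
       / (qpoch q q i * qpoch q q j * qpoch q q k))
    (qpoch_inf (q^6) (q^6) ^ 2 / (qpoch_inf q q * qpoch_inf (q^3) (q^3))).
Proof.
  intros Hq H0.
  assert (Hp : forall n, (0 < n)%nat -> (Cmod (q ^ n) < 1)%R) by (intros; now apply Cmod_pow_lt_1).
  assert (Hnz : forall m n, (0 < m)%nat -> (0 < n)%nat -> qpoch_inf (q ^ m) (q ^ n) <> 0)
    by (intros; apply qpoch_inf_nz; auto).
  (* The exponent is 2 (r^2 + r) + r^2 = 3 r^2 + 2 r, hence u = q^5 and v = q. *)
  refine (triple_sum_ext _ _ _ _ _ _ (triple_sum_bailey q q 1 (q ^ 5) q 1 (gauss_coeff q)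
    Hq Hq _ _ _ _ _ _ _)); try (apply Hp; lia); try assumption; try now apply Cpow_nz.
  - intros i j k. f_equal. rewrite <- !Cpow_add_r. f_equal. rewrite triangle_up. nia.
  - replace (q ^ 5 * q) with (q ^ 6) by ring.
    pose proof (qpoch_inf_opp_mult q q Hq) as E1.
    pose proof (qpoch_inf_split2 (q ^ 3) (q ^ 3) (Hp 3%nat ltac:(lia))) as E2.
    replace (q ^ 3 * q ^ 3) with (q ^ 6) in E2 by ring.
    replace ((q ^ 3) ^ 2) with (q ^ 6) in E2 by ring.
    pose proof (qpoch_inf_split2 q q Hq) as E3.
    replace (q * q) with (q ^ 2) in E3 by ring.
    pose proof (qpoch_inf_split3 q (q ^ 2) (Hp 2%nat ltac:(lia))) as E4.
    replace ((q ^ 2) ^ 3) with (q ^ 6) in E4 by ring.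
    replace (q * q ^ 2) with (q ^ 3) in E4 by ring.
    replace (q * (q ^ 2) ^ 2) with (q ^ 5) in E4 by ring.
    (* Euler's identity; sorted modulo 6 by [E4], its denominator cancels the theta factors
       (q;q^6)_oo and (q^5;q^6)_oo. *)
    assert (E5 : qpoch_inf (- q) q = / qpoch_inf q (q ^ 2)).
    { pose proof (Hnz 2 2)%nat as Z2. pose proof (Hnz 1 2)%nat as Z3. rewrite Cpow_1_r in Z3.
      pose proof (Hnz 1 1)%nat as Z1. rewrite Cpow_1_r in Z1.
      apply (Cmult_cancel_l (qpoch_inf q q)); [auto with arith|].
      rewrite E1, E3. field. auto with arith. }
    rewrite E5, E2, E4.
    pose proof (Hnz 1 1)%nat as Z1. pose proof (Hnz 1 6)%nat as Z2. rewrite Cpow_1_r in Z1, Z2.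
    field. repeat split; auto with arith.
  - lia.
  - intros n M HM. rewrite qpoch_opp_mult, Cmult_1_l. now apply bailey_pair_gauss; [| |lia|lia].
  - intros r. rewrite <- (Cpow_1_r q) at 5. rewrite theta_exponent by assumption. unfold gauss_coeff.
    transitivity (zpow (- (1)) r * (zpow q (r * r + Z.of_nat 1 * r) * zpow q (r * r + Z.of_nat 1 * r) * zpow q (r * r))); [ring|].
    rewrite <- !zpow_add by assumption. do 2 f_equal.
    pose proof (triangle_double_Z r). lia.
Qed.

(** Since (-q;q^2)_oo = (q^2;q^4)_oo / (q;q^2)_oo and (q^2;q^2)_oo = (q^2;q^4)_oo (q^4;q^4)_oo, the
    quotient is 1 / ((q;q^2)_oo (q^4;q^4)_oo), here sorted by residues modulo 12. In the last two
    identities the theta product cancels three of the nine factors. *)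
Lemma product_mod_12 (q : C) : (Cmod q < 1)%R ->
  qpoch_inf (- q) (q ^ 2) / qpoch_inf (q ^ 2) (q ^ 2)
  = / (qpoch_inf q (q ^ 12) * qpoch_inf (q ^ 3) (q ^ 12) * qpoch_inf (q ^ 5) (q ^ 12)
       * qpoch_inf (q ^ 7) (q ^ 12) * qpoch_inf (q ^ 9) (q ^ 12) * qpoch_inf (q ^ 11) (q ^ 12)
       * (qpoch_inf (q ^ 4) (q ^ 12) * qpoch_inf (q ^ 8) (q ^ 12) * qpoch_inf (q ^ 12) (q ^ 12))).
Proof.
  intros Hq.
  assert (Hp : forall n, (0 < n)%nat -> (Cmod (q ^ n) < 1)%R) by (intros; now apply Cmod_pow_lt_1).
  assert (Hnz : forall m n, (0 < m)%nat -> (0 < n)%nat -> qpoch_inf (q ^ m) (q ^ n) <> 0)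
    by (intros; apply qpoch_inf_nz; auto).
  pose proof (qpoch_inf_opp_mult q (q ^ 2) (Hp 2%nat ltac:(lia))) as E1.
  pose proof (qpoch_inf_split2 (q ^ 2) (q ^ 2) (Hp 2%nat ltac:(lia))) as E2.
  replace ((q ^ 2) ^ 2) with (q ^ 4) in E1, E2 by ring.
  replace (q ^ 2 * q ^ 2) with (q ^ 4) in E2 by ring.
  pose proof (qpoch_inf_split3 q (q ^ 2) (Hp 2%nat ltac:(lia))) as E3.
  replace ((q ^ 2) ^ 3) with (q ^ 6) in E3 by ring.
  replace (q * q ^ 2) with (q ^ 3) in E3 by ring.
  replace (q * (q ^ 2) ^ 2) with (q ^ 5) in E3 by ring.
  assert (S6 : forall m, qpoch_inf (q ^ m) (q ^ 6) = qpoch_inf (q ^ m) (q ^ 12) * qpoch_inf (q ^ (m + 6)) (q ^ 12)).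
  { intros m. rewrite (qpoch_inf_split2 (q ^ m) (q ^ 6) (Hp 6%nat ltac:(lia))).
    rewrite <- Cpow_add_r. replace ((q ^ 6) ^ 2) with (q ^ 12) by ring. reflexivity. }
  pose proof (S6 1)%nat as S1. rewrite Cpow_1_r in S1.
  rewrite S1, (S6 3)%nat, (S6 5)%nat in E3. simpl Nat.add in E3.
  pose proof (qpoch_inf_split3 (q ^ 4) (q ^ 4) (Hp 4%nat ltac:(lia))) as E4.
  replace ((q ^ 4) ^ 3) with (q ^ 12) in E4 by ring.
  replace (q ^ 4 * (q ^ 4) ^ 2) with (q ^ 12) in E4 by ring.
  replace (q ^ 4 * q ^ 4) with (q ^ 8) in E4 by ring.
  pose proof (Hnz 1 2)%nat as Z2. pose proof (Hnz 1 12)%nat as Z3. rewrite Cpow_1_r in Z2, Z3.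
  replace (qpoch_inf (- q) (q ^ 2)) with (qpoch_inf (q ^ 2) (q ^ 4) / qpoch_inf q (q ^ 2))
    by (rewrite <- E1; field; auto with arith).
  rewrite E2, E3, E4. field. repeat split; auto with arith.
Qed.

Lemma identity_6 (q : C) : (Cmod q < 1)%R -> q <> 0 ->
  triple_sum
    (fun i j k => q ^ (4*i*i + 2*j*j + k*k + 4*i*j + 2*i*k)
       / (qpoch (q^2) (q^2) i * qpoch (q^2) (q^2) j * qpoch (q^2) (q^2) k))
    (1 / (qpoch_inf q (q^12) * qpoch_inf (q^3) (q^12) * qpoch_inf (q^4) (q^12)
          * qpoch_inf (q^8) (q^12) * qpoch_inf (q^9) (q^12)
          * qpoch_inf (q^11) (q^12))).
Proof.
  intros Hq H0.
  assert (Hp : forall n, (0 < n)%nat -> (Cmod (q ^ n) < 1)%R) by (intros; now apply Cmod_pow_lt_1).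
  assert (Hnz : forall m n, (0 < m)%nat -> (0 < n)%nat -> qpoch_inf (q ^ m) (q ^ n) <> 0)
    by (intros; apply qpoch_inf_nz; auto).
  (* In base q^2 the exponent becomes 4 r^2 + 2 r^2 + r = 6 r^2 + r, hence u = q^7 and v = q^5. *)
  refine (triple_sum_ext _ _ _ _ _ _ (triple_sum_bailey (q ^ 2) q 1 (q ^ 7) (q ^ 5) 0 (half_coeff q)
    _ Hq _ _ _ _ _ _ _)); try (apply Hp; lia); try now apply Cpow_nz.
  - intros i j k. f_equal. rewrite <- !Cpow_mult_r, <- !Cpow_add_r. f_equal.
    pose proof (triangle_double k). nia.
  - replace (q ^ 7 * q ^ 5) with (q ^ 12) by ring.
    match goal with |- ?x * ?a * ?b / ?c = _ => transitivity (x * (a / c * b)); [unfold Cdiv; ring|] end.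
    rewrite product_mod_12 by assumption.
    pose proof (Hnz 1 12)%nat as Z3. rewrite Cpow_1_r in Z3.
    field. repeat split; auto with arith.
  - lia.
  - intros n M HM. rewrite Cmult_1_l. now apply bailey_pair_half.
  - intros r. rewrite theta_exponent by assumption. unfold half_coeff. rewrite !zpow_pow by assumption.
    match goal with |- ?a * ?b * (?c * ?d) = _ => transitivity (c * (a * b * d)); [ring|] end.
    rewrite <- !zpow_add by assumption. do 2 f_equal.
    pose proof (triangle_double_Z r). lia.
Qed.

Lemma identity_7 (q : C) : (Cmod q < 1)%R -> q <> 0 ->
  triple_sum
    (fun i j k => q ^ (4*i*i + 2*j*j + k*k + 4*i*j + 2*i*k + 4*i + 2*j + 2*k)
       / (qpoch (q^2) (q^2) i * qpoch (q^2) (q^2) j * qpoch (q^2) (q^2) k))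
    (1 / (qpoch_inf (q^3) (q^12) * qpoch_inf (q^4) (q^12) * qpoch_inf (q^5) (q^12)
          * qpoch_inf (q^7) (q^12) * qpoch_inf (q^8) (q^12)
          * qpoch_inf (q^9) (q^12))).
Proof.
  intros Hq H0.
  assert (Hp : forall n, (0 < n)%nat -> (Cmod (q ^ n) < 1)%R) by (intros; now apply Cmod_pow_lt_1).
  assert (Hnz : forall m n, (0 < m)%nat -> (0 < n)%nat -> qpoch_inf (q ^ m) (q ^ n) <> 0)
    by (intros; apply qpoch_inf_nz; auto).
  (* The exponent is 4 (r^2 + r) + 2 r^2 + r = 6 r^2 + 5 r, hence u = q^11 and v = q. *)
  refine (triple_sum_ext _ _ _ _ _ _ (triple_sum_bailey (q ^ 2) (q ^ 3) (1 + q) (q ^ 11) q 1 (half_coeff q)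
    _ _ _ Hq _ H0 _ _ _)); try (apply Hp; lia); try now apply Cpow_nz.
  - intros i j k. f_equal. rewrite <- !Cpow_mult_r, <- !Cpow_add_r. f_equal.
    pose proof (triangle_double k). nia.
  - replace (q ^ 11 * q) with (q ^ 12) by ring.
    replace (- q ^ 3) with (- q * q ^ 2) by ring.
    replace ((1 + q) * qpoch_inf (- q * q ^ 2) (q ^ 2)) with (qpoch_inf (- q) (q ^ 2))
      by (rewrite (qpoch_inf_shift (- q)) by (apply Hp; lia); ring).
    match goal with |- ?a * ?b / ?c = _ => transitivity (a / c * b); [unfold Cdiv; ring|] end.
    rewrite product_mod_12 by assumption.
    pose proof (Hnz 1 12)%nat as Z3. rewrite Cpow_1_r in Z3.
    field. repeat split; auto with arith.
  - lia.
  - intros n M HM. destruct (bailey_pair_half q n M Hq H0 HM) as [_ E].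
    refine (eq_trans _ E). change (S n) with (1 + n)%nat. rewrite qpoch_add, Cpow_1_r.
    replace (- q ^ 3) with (- q * q ^ 2) by ring. simpl (qpoch (- q) (q ^ 2) 1). ring.
  - intros r. rewrite <- (Cpow_1_r q) at 5. rewrite theta_exponent by assumption.
    unfold half_coeff. rewrite !zpow_pow by assumption.
    match goal with |- ?a * ?b * (?c * ?d) = _ => transitivity (c * (a * b * d)); [ring|] end.
    rewrite <- !zpow_add by assumption. do 2 f_equal.
    pose proof (triangle_double_Z r). lia.
Qed.

Lemma triple_sum_base_0 (e : nat -> nat -> nat -> nat) (d : nat -> nat -> nat -> C) (l : C) :
  (forall i j k, (0 < i + j + k)%nat -> (0 < e i j k)%nat) -> e 0%nat 0%nat 0%nat = 0%nat ->
  d 0%nat 0%nat 0%nat = 1 -> l = 1 ->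
  triple_sum (fun i j k => 0 ^ e i j k / d i j k) l.
Proof.
  intros He He0 Hd Hl.
  refine (triple_sum_ext _ _ _ _ (fun i j k => eq_refl) _ (triple_sum_origin _ _)).
  - rewrite He0, Hd, Hl. simpl. field.
  - intros i j k H. rewrite Cpow_0_l by now apply He. unfold Cdiv. ring.
Qed.

(* s is the fixed choice of q^(1/2): s * s = q.  Exponents are natural
   numbers; (k*(k+1))/2 = k^2/2 + k/2 exactly. *)
Theorem theorem4p9 (q s : C) (hq : (Cmod q < 1)%R) (hs : s * s = q) :
  triple_sum
    (fun i j k => q ^ (2*i*i + j*j + (k*(k+1))/2 + 2*i*j + i*k - i - j)
       / (qpoch q q i * qpoch q q j * qpoch q q k))
    (2 * qpoch_inf (q^2) (q^2) ^ 2 / qpoch_inf q q ^ 2)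
  /\
  triple_sum
    (fun i j k => s ^ (4*i*i + 2*j*j + k*k + 4*i*j + 2*i*k - j + k)
       / (qpoch q q i * qpoch q q j * qpoch q q k))
    (1 / qpoch_inf s q)
  /\
  triple_sum
    (fun i j k => q ^ (2*i*i + j*j + (k*(k+1))/2 + 2*i*j + i*k + i)
       / (qpoch q q i * qpoch q q j * qpoch q q k))
    (qpoch_inf (q^2) (q^2) ^ 2 / qpoch_inf q q ^ 2)
  /\
  triple_sum
    (fun i j k => q ^ (2*i*i + j*j + (k*(k+1))/2 + 2*i*j + i*k)
       / (qpoch q q i * qpoch q q j * qpoch q q k))
    (qpoch_inf (q^2) (q^2) * qpoch_inf (q^3) (q^3) ^ 2
       / (qpoch_inf q q ^ 2 * qpoch_inf (q^6) (q^6)))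
  /\
  triple_sum
    (fun i j k => q ^ (2*i*i + j*j + (k*(k+1))/2 + 2*i*j + i*k + 2*i + j)
       / (qpoch q q i * qpoch q q j * qpoch q q k))
    (qpoch_inf (q^6) (q^6) ^ 2 / (qpoch_inf q q * qpoch_inf (q^3) (q^3)))
  /\
  triple_sum
    (fun i j k => q ^ (4*i*i + 2*j*j + k*k + 4*i*j + 2*i*k)
       / (qpoch (q^2) (q^2) i * qpoch (q^2) (q^2) j * qpoch (q^2) (q^2) k))
    (1 / (qpoch_inf q (q^12) * qpoch_inf (q^3) (q^12) * qpoch_inf (q^4) (q^12)
          * qpoch_inf (q^8) (q^12) * qpoch_inf (q^9) (q^12)
          * qpoch_inf (q^11) (q^12)))
  /\
  triple_sum
    (fun i j k => q ^ (4*i*i + 2*j*j + k*k + 4*i*j + 2*i*k + 4*i + 2*j + 2*k)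
       / (qpoch (q^2) (q^2) i * qpoch (q^2) (q^2) j * qpoch (q^2) (q^2) k))
    (1 / (qpoch_inf (q^3) (q^12) * qpoch_inf (q^4) (q^12) * qpoch_inf (q^5) (q^12)
          * qpoch_inf (q^7) (q^12) * qpoch_inf (q^8) (q^12)
          * qpoch_inf (q^9) (q^12))).
Proof.
  destruct (identities_1_2_3 q s hq hs) as [I1 [I2 I3]].
  split; [exact I1|]. split; [exact I2|]. split; [exact I3|]. clear I1 I2 I3.
  (* Negative powers of q in the bilateral sums require q <> 0. At q = 0 only the term at the origin
     survives, and both sides of the remaining four identities equal 1. *)
  destruct (Ceq_dec q 0) as [H0|H0].
  - clear s hs. subst q.
    split; [|split; [|split]];
      match goal with
      | |- triple_sum (fun i j k => _ ^ @?e i j k / @?d i j k) _ => apply (triple_sum_base_0 e d)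
      end;
      try reflexivity; try (intros [|i] [|j] [|k]; rewrite ?triangle_up; nia); try (simpl; ring);
      rewrite ?Cpow_0_l, !qpoch_inf_0 by (lia || (rewrite Cmod_0; lra)); field.
  - split; [now apply identity_4|]. split; [now apply identity_5|].
    split; [now apply identity_6|now apply identity_7].
Qed.
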